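(* Let $\mu_4$ and $\mu_{16}$ be the standard one-fourth and one-sixteenth Cantor measures with digit set $\{0,1\}$. For an angle $\theta\in(-\pi,\pi]$ let $R_\theta$ be the anticlockwise rotation of $\mathbb{R}^2$ by $\theta$, and define the measure on $\mathbb{R}^2$ $$\rho_\theta(E)=(\mu_4\times\delta_0)(E)+(\delta_0\times\mu_{16})(R_\theta^{-1}(E)),\qquad E\subset\mathbb{R}^2 \text{ Borel}.$$ Then $\rho_\theta$ is a frame-spectral measure whenever $\theta\neq\pm\pi/2$, and $\rho_\theta$ is not frame-spectral when $\theta=\pm\pi/2$. Furthermore, there are constants $0<A\le B<\infty$ independent of $\theta$ such that for every $\theta\ne\pm\pi/2$ there is a countable set $\Lambda_\theta\subset\mathbb{R}^2$ for which $\{e^{2\pi i\langle\lambda,x\rangle}\}_{\lambda\in\Lambda_\theta}$ is a Fourier frame for $\rho_\theta$ with frame bounds $A,B$.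
   Context: $\mu_4$ and $\mu_{16}$ are the unique Borel probability measures on $\mathbb{R}$ satisfying $\mu_4(E)=\frac12\mu_4(4E)+\frac12\mu_4(4E-1)$ and $\mu_{16}(E)=\frac12\mu_{16}(16E)+\frac12\mu_{16}(16E-1)$ for all Borel $E$. A finite Borel measure $\rho$ on $\mathbb{R}^n$ is frame-spectral if there are a countable set $\Lambda\subset\mathbb{R}^n$ and constants $0<A\le B<\infty$ (frame bounds) with $A\|f\|_{L^2(\rho)}^2\le\sum_{\lambda\in\Lambda}\left|\int f(x)e^{2\pi i\langle\lambda,x\rangle}d\rho(x)\right|^2\le B\|f\|_{L^2(\rho)}^2$ for all $f\in L^2(\rho)$; then $\{e^{2\pi i\langle\lambda,x\rangle}\}_{\lambda\in\Lambda}$ is called a Fourier frame for $\rho$. *)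

(* Defs.v *)
From HB Require Import structures.
From mathcomp Require Import all_boot all_order all_algebra.
From mathcomp Require Import all_classical all_reals all_analysis.
From mathcomp Require Import complex.

Set Implicit Arguments.
Unset Strict Implicit.
Unset Printing Implicit Defensive.

Import Order.TTheory GRing.Theory Num.Theory.
Import numFieldNormedType.Exports measurable_realfun.

Local Open Scope classical_set_scope.
Local Open Scope complex_scope.
Local Open Scope ring_scope.

Definition cantor_measure (R : realType) (N : nat) (mu : probability R R) : Prop :=
  forall E : set R, measurable E ->
    mu E = ((2^-1)%:E * mu [set (N%:R * x)%R | x in E] +
            (2^-1)%:E * mu [set (N%:R * x - 1)%R | x in E])%E.

Section Rho.
Context {R : realType}.
Implicit Types theta : R.

Definition rotation theta (x : R * R) : R * R :=
  (cos theta * x.1 - sin theta * x.2, sin theta * x.1 + cos theta * x.2).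

Lemma measurable_rotation theta : measurable_fun setT (rotation theta).
Proof.
have mfst : measurable_fun setT (@fst R R) by exact: measurable_fst.
have msnd : measurable_fun setT (@snd R R) by exact: measurable_snd.
apply: measurable_fun_pair.
- by apply: measurable_funB; apply: measurable_funM.
- by apply: measurable_funD; apply: measurable_funM.
Qed.

Definition rho (mu4 mu16 : probability R R) theta (E : set (R * R)) : \bar R :=
  ((mu4 \x \d_(0%R : R)) E + (\d_(0%R : R) \x mu16) (rotation theta @^-1` E))%E.

Variables (mu4 mu16 : probability R R) (theta : R).

Let rotated := pushforward (\d_(0%R : R) \x mu16)%E (rotation theta).

Let rotated0 : rotated set0 = 0%E.
Proof. by apply: measure0; exact: measurable_rotation. Qed.

Let rotated_ge0 E : (0 <= rotated E)%E.
Proof. by apply: measure_ge0; exact: measurable_rotation. Qed.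

Let rotated_sigma_additive : semi_sigma_additive rotated.
Proof.
by apply: measure_semi_sigma_additive; exact: measurable_rotation.
Qed.

HB.instance Definition _ := isMeasure.Build _ _ _ rotated
  rotated0 rotated_ge0 rotated_sigma_additive.

Let rhoE : rho mu4 mu16 theta = measure_add (mu4 \x \d_(0%R : R))%E rotated.
Proof. by apply/funext => E; rewrite measure_addE. Qed.

Let rho0 : rho mu4 mu16 theta set0 = 0%E.
Proof. by rewrite rhoE; exact: measure0. Qed.

Let rho_ge0 E : (0 <= rho mu4 mu16 theta E)%E.
Proof. by rewrite rhoE; exact: measure_ge0. Qed.

Let rho_sigma_additive : semi_sigma_additive (rho mu4 mu16 theta).
Proof. by rewrite rhoE; exact: measure_semi_sigma_additive. Qed.

HB.instance Definition _ := isMeasure.Build _ _ _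
  (rho mu4 mu16 theta) rho0 rho_ge0 rho_sigma_additive.

Let rho_fin : fin_num_fun (rho mu4 mu16 theta).
Proof.
apply: lty_fin_num_fun => /=.
have -> : rho mu4 mu16 theta setT = (1 * 1 + 1 * 1)%E.
  rewrite /rho preimage_setT -!setXTT !product_measure1E//.
  by congr (_ * _ + _ * _)%E;
    solve [exact: probability_setT | exact: diracT].
by rewrite !mule1 -EFinD ltry.
Qed.

HB.instance Definition _ := Measure_isFinite.Build _ _ _
  (rho mu4 mu16 theta) rho_fin.

End Rho.

Section FourierFrame.
Context {R : realType}.
Implicit Types (m : {finite_measure set (R * R)%type -> \bar R}) (f : R * R -> R[i]).

Definition dotp (l x : R * R) : R := l.1 * x.1 + l.2 * x.2.

(* e^(2 pi i <l, x>) *)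
Definition fourier_char (l x : R * R) : R[i] :=
  cos (2 * pi * dotp l x) +i* sin (2 * pi * dotp l x).

(* Normc.normc is the real-valued modulus on R[i]. *)
Definition L2normsq m f : \bar R := (\int[m]_x (Normc.normc (f x) ^+ 2)%:E)%E.

(* Members of L^2(m) are represented by functions; [fourier_frame] depends
   only on their classes modulo m-almost-everywhere equality. *)
Definition L2 m f : Prop :=
  [/\ measurable_fun setT (fun x => complex.Re (f x)),
      measurable_fun setT (fun x => complex.Im (f x)) &
      (L2normsq m f < +oo)%E].

Definition cintegral m f : R[i] :=
  (\int[m]_x complex.Re (f x)) +i* (\int[m]_x complex.Im (f x)).

Definition fourier_frame m (Lambda : set (R * R)) (A B : R) : Prop :=
  forall f, L2 m f ->
    (A%:E * L2normsq m f
       <= \esum_(l in Lambda)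
            (Normc.normc (cintegral m (fun x => f x * fourier_char l x)) ^+ 2)%:E
       <= B%:E * L2normsq m f)%E.

Definition frame_spectral m : Prop :=
  exists (Lambda : set (R * R)) (A B : R),
    [/\ countable Lambda, 0 < A, A <= B & fourier_frame m Lambda A B].

End FourierFrame.

(* Main.v *)
Require Import Defs.
From mathcomp Require Import all_boot all_order all_algebra.
From mathcomp Require Import all_classical all_reals all_analysis.
From mathcomp Require Import complex finmap.
From mathcomp Require Import zify ring lra.

(** The supporting lines of the two components of [rho theta] are distinct exactly
    when [cos theta <> 0]. In that case the frequencies along the two lines can be
    prescribed independently, so one needs pairs of frequencies (a, b) for which
    the sum of |f^(a) + g^(b)|^2 is comparable to |f|^2 + |g|^2, and theta plays no
    role. The spectrum of each Cantor measure yields a frame: a unitary cascade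
    splits |f^|^2 over the first 2^n frequencies into 2^n means, each bounded by
    the norm of its branch, and bounded below when f is Lipschitz; Lipschitz
    functions are dense. Pairing the two spectra along the edges of a 4-ary tree
    then works because the Laplacian of the tree has a spectral gap.

    If [cos theta = 0], both components live on the x-axis. As mu4 is the
    convolution of mu16 with a dilate of itself, |mu4^| <= |mu16^|; testing a frame
    at scale 16^-n on indicators of small intervals, the lower bound for mu4 gives
    at least 4^n while the upper bound for mu16 gives at most 2^n. *)

(** Pairing the k-th frequency of one component with the k-th of the other fails: opposite
    coefficients of f and g would cancel in every pair. Along tree edges, cancellation copies a
    coefficient, up to sign, onto four children, which multiplies the energy by four;
    square-summability forbids this. Edges in both directions let each sequence control the other,
    and four exceeds the loss 2 in |u + v|^2 <= 2|u|^2 + 2|v|^2.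

    In the lower bound for one Cantor measure, the transform of 1 has zeros and the phases of the
    cascade do not flatten. They are therefore carried as an explicit frequency, which never leaves
    [0, 2/3], where the transform of 1 is bounded below.

    In the parallel case one test function cannot separate the components, since both have mass near
    0. A small interval at 1/4 is charged by [mu4] alone and gives the lower bound; one at 0 of the
    same length is charged by both and gives the upper bound, where [mu16], with mass 2^-n against
    4^-n, dominates. *)

Import Order.TTheory GRing.Theory Num.Theory.
Import numFieldNormedType.Exports measurable_realfun.

Local Open Scope classical_set_scope.
Local Open Scope complex_scope.
Local Open Scope ring_scope.

Set Implicit Arguments.
Unset Strict Implicit.
Unset Printing Implicit Defensive.

(** * Integration against a mixture of push-forwards *)

Section Mixture.
Context {R : realType} {d d1 d2 : measure_display} {Y : measurableType d}
  {X1 : measurableType d1} {X2 : measurableType d2}.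
Variables (mu : {measure set Y -> \bar R}) (m1 : {measure set X1 -> \bar R})
  (m2 : {measure set X2 -> \bar R}) (phi1 : X1 -> Y) (phi2 : X2 -> Y) (a : R).
Hypotheses (mphi1 : measurable_fun setT phi1) (mphi2 : measurable_fun setT phi2).
Hypothesis a_gt0 : 0 < a.
Hypothesis muE : forall E, measurable E ->
  mu E = (a%:E * m1 (phi1 @^-1` E) + a%:E * m2 (phi2 @^-1` E))%E.

(** The free weight makes one statement serve twice: with 1/2 and the two digit contractions for a
    Cantor measure, with 1 and the embeddings of the two lines for [rho]. *)
Lemma ge0_integral_mixture (f : Y -> \bar R) :
  measurable_fun setT f -> (forall x, 0 <= f x)%E ->
  (\int[mu]_x f x = a%:E * \int[m1]_x f (phi1 x) + a%:E * \int[m2]_x f (phi2 x))%E.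
Proof.
move=> mf f0.
pose k : {nonneg R} := NngNum (ltW a_gt0).
pose p1 : {measure set Y -> \bar R} :=
  measure_function_pushforward__canonical__measure_function_Measure m1 mphi1.
pose p2 : {measure set Y -> \bar R} :=
  measure_function_pushforward__canonical__measure_function_Measure m2 mphi2.
rewrite (eq_measure_integral (measure_add (mscale k p1) (mscale k p2))); last first.
  move=> A mA _; rewrite muE//.
  exact/esym/(measure_addE (mscale k p1) (mscale k p2) A).
rewrite (ge0_integral_measure_add _ _ _ _ _)//.
rewrite !(ge0_integral_mscale _ _ _ _ _)//.
rewrite (ge0_integral_pushforward mphi1 m1)//.
by rewrite (ge0_integral_pushforward mphi2 m2).
Qed.

Lemma integrable_mixture (f : Y -> \bar R) : mu.-integrable setT f ->
  m1.-integrable setT (f \o phi1) /\ m2.-integrable setT (f \o phi2).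
Proof.
move=> /integrableP[mf foo].
rewrite ge0_integral_mixture// in foo; last exact: measurableT_comp.
have I1 : (0 <= \int[m1]_x `|f (phi1 x)|)%E by apply: integral_ge0.
have I2 : (0 <= \int[m2]_x `|f (phi2 x)|)%E by apply: integral_ge0.
have a0 : (0 <= a%:E)%E by rewrite lee_fin ltW.
have fin (x y : \bar R) : (0 <= x)%E -> (0 <= y)%E ->
    (a%:E * x + a%:E * y < +oo)%E -> (x < +oo)%E.
  move=> x0 y0; apply: contraTT; rewrite -!leNgt !leye_eq => /eqP ->.
  by rewrite gt0_muley ?lte_fin// addye// gt_eqF// (lt_le_trans _ (mule_ge0 a0 y0)).
split; apply/integrableP; split; try exact: measurableT_comp.
- exact: fin I1 I2 foo.
- by apply: fin I2 I1 _; rewrite addeC.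
Qed.

Lemma Rintegral_mixture (f : Y -> R) : mu.-integrable setT (EFin \o f) ->
  \int[mu]_x f x = a * \int[m1]_x f (phi1 x) + a * \int[m2]_x f (phi2 x).
Proof.
move=> fi; have [fi1 fi2] := integrable_mixture fi.
have pm (g : Y -> \bar R) : mu.-integrable setT g -> (forall x, 0 <= g x)%E ->
    fine (\int[mu]_x g x) = a * fine (\int[m1]_x g (phi1 x))
                            + a * fine (\int[m2]_x g (phi2 x)).
  move=> gi g0; have [gi1 gi2] := integrable_mixture gi.
  rewrite ge0_integral_mixture//; last exact: measurable_int gi.
  have F1 := integrable_fin_num measurableT gi1.
  have F2 := integrable_fin_num measurableT gi2.
  by rewrite fineD ?fin_numM// !fineM.
have split_int dZ (Z : measurableType dZ) (m : {measure set Z -> \bar R})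
    (g : Z -> \bar R) : m.-integrable setT g ->
    fine (\int[m]_x g x) = fine (\int[m]_x g^\+ x)%E - fine (\int[m]_x g^\- x)%E.
  move=> gi; rewrite integralE fineB//; apply: integrable_fin_num => //.
    exact: integrable_funepos.
  exact: integrable_funeneg.
have fE : \int[mu]_x f x = fine (\int[mu]_x (EFin \o f)^\+ x)%E -
  fine (\int[mu]_x (EFin \o f)^\- x)%E by exact: split_int.
have f1E : \int[m1]_x f (phi1 x) = fine (\int[m1]_x (EFin \o f)^\+ (phi1 x))%E -
  fine (\int[m1]_x (EFin \o f)^\- (phi1 x))%E.
  by have := split_int _ _ m1 _ fi1; rewrite funepos_comp funeneg_comp.
have f2E : \int[m2]_x f (phi2 x) = fine (\int[m2]_x (EFin \o f)^\+ (phi2 x))%E -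
  fine (\int[m2]_x (EFin \o f)^\- (phi2 x))%E.
  by have := split_int _ _ m2 _ fi2; rewrite funepos_comp funeneg_comp.
rewrite fE f1E f2E pm; [|exact: integrable_funepos|by []].
rewrite pm; [|exact: integrable_funeneg|by []].
by rewrite !mulrBr opprD addrACA.
Qed.

End Mixture.

(** * Complex square-integrable functions *)

Section SquaredModulus.
Context {R : realType}.
Implicit Types z w : R[i].

(** Squared moduli are polynomial in the real and imaginary parts, which keeps square roots out of
    the estimates. *)
Definition nsq z : R := complex.Re z ^+ 2 + complex.Im z ^+ 2.

Lemma nsq_ge0 z : 0 <= nsq z.
Proof. by rewrite addr_ge0// sqr_ge0. Qed.

Lemma nsqE z : Normc.normc z ^+ 2 = nsq z.
Proof. by case: z => a b; rewrite /nsq /= sqr_sqrtr// addr_ge0// sqr_ge0. Qed.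

Lemma nsqM z w : nsq (z * w) = nsq z * nsq w.
Proof. by case: z w => [a b] [c d]; rewrite /nsq /=; ring. Qed.

Lemma nsqN z : nsq (- z) = nsq z.
Proof. by case: z => a b; rewrite /nsq /=; ring. Qed.

Lemma nsq_parallelogram z w : nsq (z + w) + nsq (z - w) = 2 * nsq z + 2 * nsq w.
Proof. by case: z w => [a b] [c d]; rewrite /nsq /=; ring. Qed.

Lemma nsqD_le z w : nsq (z + w) <= 2 * nsq z + 2 * nsq w.
Proof. by rewrite -nsq_parallelogram lerDl nsq_ge0. Qed.

Lemma nsqB_le z w : nsq (z - w) <= 2 * nsq z + 2 * nsq w.
Proof. by rewrite -(nsqN w) nsqD_le. Qed.

Lemma nsq_real (a : R) : nsq (a%:C) = a ^+ 2.
Proof. by rewrite /nsq /= expr0n /= addr0. Qed.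

Lemma nsq0 : nsq 0 = 0.
Proof. by rewrite (nsq_real 0) expr0n. Qed.

Lemma nsq1 : nsq 1 = 1.
Proof. by rewrite (nsq_real 1) expr1n. Qed.

Lemma complex_ReIm z w : complex.Re z = complex.Re w ->
  complex.Im z = complex.Im w -> z = w.
Proof. by case: z w => [a b] [c d] /= -> ->. Qed.

End SquaredModulus.

Section ComplexL2.
Context {R : realType} {d : measure_display} {T : measurableType d}.
Implicit Types (m : {finite_measure set T -> \bar R}) (f g : T -> R[i]).

Definition cmeasurable f :=
  measurable_fun setT (fun x => complex.Re (f x)) /\
  measurable_fun setT (fun x => complex.Im (f x)).

Definition cL2 (m : {measure set T -> \bar R}) f :=
  cmeasurable f /\ m.-integrable setT (EFin \o (fun x => nsq (f x))).

Definition cint (m : {measure set T -> \bar R}) f : R[i] :=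
  (\int[m]_x complex.Re (f x)) +i* (\int[m]_x complex.Im (f x)).

Definition norm2 (m : {measure set T -> \bar R}) f : R := \int[m]_x nsq (f x).

Lemma measurable_nsq f : cmeasurable f -> measurable_fun setT (fun x => nsq (f x)).
Proof. by move=> [m1 m2]; apply: measurable_funD; exact: measurable_funX. Qed.

Lemma cmeasurable_cst (c : R[i]) : cmeasurable (fun=> c).
Proof. by split; exact: measurable_cst. Qed.

Lemma cmeasurableD f g : cmeasurable f -> cmeasurable g ->
  cmeasurable (fun x => f x + g x).
Proof.
move=> [f1 f2] [g1 g2]; split.
- rewrite (_ : (fun _ => _) = (fun x => complex.Re (f x) + complex.Re (g x))).
    exact: measurable_funD.
  by apply/funext => x; case: (f x) (g x) => ? ? [].
- rewrite (_ : (fun _ => _) = (fun x => complex.Im (f x) + complex.Im (g x))).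
    exact: measurable_funD.
  by apply/funext => x; case: (f x) (g x) => ? ? [].
Qed.

Lemma cmeasurableM f g : cmeasurable f -> cmeasurable g ->
  cmeasurable (fun x => f x * g x).
Proof.
move=> [f1 f2] [g1 g2]; split.
- rewrite (_ : (fun _ => _) = (fun x => complex.Re (f x) * complex.Re (g x) -
     complex.Im (f x) * complex.Im (g x))).
    by apply: measurable_funB; exact: measurable_funM.
  by apply/funext => x; case: (f x) (g x) => ? ? [].
- rewrite (_ : (fun _ => _) = (fun x => complex.Re (f x) * complex.Im (g x) +
     complex.Im (f x) * complex.Re (g x))).
    by apply: measurable_funD; exact: measurable_funM.
  by apply/funext => x; case: (f x) (g x) => ? ? [].
Qed.

Lemma cmeasurableN f : cmeasurable f -> cmeasurable (fun x => - f x).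
Proof.
move=> mf; rewrite (_ : (fun _ => _) = (fun x => (-1) * f x)).
  exact/cmeasurableM/mf/cmeasurable_cst.
by apply/funext => x; rewrite mulN1r.
Qed.

Lemma le_Rintegrable (m : {measure set T -> \bar R}) (u v : T -> R) :
  measurable_fun setT u ->
  (forall x, `|u x| <= v x) -> m.-integrable setT (EFin \o v) ->
  m.-integrable setT (EFin \o u).
Proof.
move=> mu uv; apply: le_integrable => //; first exact/measurable_EFinP.
by move=> x _; rewrite lee_fin (le_trans (uv x))// ler_norm.
Qed.

Lemma Rintegrable_cst m (c : R) : m.-integrable setT (EFin \o (fun=> c)).
Proof. exact: finite_measure_integrable_cst. Qed.

Lemma RintegrableD (m : {measure set T -> \bar R}) (u v : T -> R) :
  m.-integrable setT (EFin \o u) -> m.-integrable setT (EFin \o v) ->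
  m.-integrable setT (EFin \o (fun x => u x + v x)).
Proof. by move=> iu iv; exact: (integrableD measurableT iu iv). Qed.

Lemma RintegrableZ (m : {measure set T -> \bar R}) (c : R) (u : T -> R) :
  m.-integrable setT (EFin \o u) ->
  m.-integrable setT (EFin \o (fun x => c * u x)).
Proof. by move=> iu; exact: (integrableZl measurableT c iu). Qed.

Lemma le_cL2 m f (v : T -> R) : cmeasurable f -> (forall x, nsq (f x) <= v x) ->
  m.-integrable setT (EFin \o v) -> cL2 m f.
Proof.
move=> mf fv iv; split=> //; apply: le_Rintegrable iv => //.
  exact: measurable_nsq.
by move=> x; rewrite ger0_norm// nsq_ge0.
Qed.

Lemma cL2D m f g : cL2 m f -> cL2 m g -> cL2 m (fun x => f x + g x).
Proof.
move=> [mf jf] [mg jg].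
apply: (@le_cL2 _ _ (fun x => 2 * nsq (f x) + 2 * nsq (g x))).
- exact: cmeasurableD.
- by move=> x; exact: nsqD_le.
- by apply: RintegrableD; exact: RintegrableZ.
Qed.

Lemma cL2M1 m f g : cL2 m f -> cmeasurable g -> (forall x, nsq (g x) <= 1) ->
  cL2 m (fun x => f x * g x).
Proof.
move=> [mf jf] mg g1; apply: (@le_cL2 _ _ (fun x => nsq (f x))) => //.
- exact: cmeasurableM.
- by move=> x; rewrite nsqM ler_piMr// nsq_ge0.
Qed.

Lemma cL2Z m c f : cL2 m f -> cL2 m (fun x => c * f x).
Proof.
move=> [mf jf]; apply: (@le_cL2 _ _ (fun x => nsq c * nsq (f x))) => //.
- exact/cmeasurableM/mf/cmeasurable_cst.
- by move=> x; rewrite nsqM.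
- exact: RintegrableZ.
Qed.

Lemma cL2N m f : cL2 m f -> cL2 m (fun x => - f x).
Proof.
move=> /(cL2Z (-1)); congr (cL2 m _).
by apply/funext => x; rewrite mulN1r.
Qed.

Lemma cL2B m f g : cL2 m f -> cL2 m g -> cL2 m (fun x => f x - g x).
Proof. by move=> hf hg; apply: cL2D => //; exact: cL2N. Qed.

Lemma cL2_cst m c : cL2 m (fun=> c).
Proof. by split; [exact: cmeasurable_cst|exact: Rintegrable_cst]. Qed.

Lemma cL2_Re m f : cL2 m f -> m.-integrable setT (EFin \o (fun x => complex.Re (f x))).
Proof.
move=> [[mf _] jf]; apply: (@le_Rintegrable _ _ (fun x => 1 + nsq (f x))) => //.
  move=> x; rewrite /nsq.
  set a := complex.Re _; set b := complex.Im _.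
  have := sqr_ge0 (`|a| - 1); have := sqr_ge0 b; have := normr_ge0 a.
  by rewrite -(real_normK (num_real a)); nra.
by apply: RintegrableD => //; exact: Rintegrable_cst.
Qed.

Lemma cL2_Im m f : cL2 m f -> m.-integrable setT (EFin \o (fun x => complex.Im (f x))).
Proof.
move=> [[_ mf] jf]; apply: (@le_Rintegrable _ _ (fun x => 1 + nsq (f x))) => //.
  move=> x; rewrite /nsq.
  set a := complex.Re _; set b := complex.Im _.
  have := sqr_ge0 (`|b| - 1); have := sqr_ge0 a; have := normr_ge0 b.
  by rewrite -(real_normK (num_real b)); nra.
by apply: RintegrableD => //; exact: Rintegrable_cst.
Qed.

Lemma cintD m f g : cL2 m f -> cL2 m g ->
  cint m (fun x => f x + g x) = cint m f + cint m g.
Proof.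
move=> hf hg; apply: complex_ReIm => /=.
- rewrite -RintegralD//; [|exact: cL2_Re|exact: cL2_Re].
  by apply: eq_Rintegral => x _; case: (f x) (g x) => ? ? [].
- rewrite -RintegralD//; [|exact: cL2_Im|exact: cL2_Im].
  by apply: eq_Rintegral => x _; case: (f x) (g x) => ? ? [].
Qed.

Lemma cintZ m c f : cL2 m f -> cint m (fun x => c * f x) = c * cint m f.
Proof.
move=> hf; have hR := cL2_Re hf; have hI := cL2_Im hf.
case: c => a b; apply: complex_ReIm => /=.
- rewrite -!RintegralZl// -RintegralB//; [|exact: RintegrableZ..].
  by apply: eq_Rintegral => x _; case: (f x).
- rewrite -!RintegralZl// -RintegralD//; [|exact: RintegrableZ..].
  by apply: eq_Rintegral => x _; case: (f x).
Qed.

Lemma eq_cint (m : {measure set T -> \bar R}) f g : f =1 g -> cint m f = cint m g.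
Proof. by move=> /funext ->. Qed.

Lemma cintB m f g : cL2 m f -> cL2 m g ->
  cint m (fun x => f x - g x) = cint m f - cint m g.
Proof.
move=> hf hg; rewrite cintD//; last exact: cL2N.
by rewrite (@eq_cint _ (fun x => - g x) (fun x => -1 * g x)) ?cintZ ?mulN1r// => x;
  rewrite mulN1r.
Qed.

(** Nonnegativity of the variance: expand the integral of (u - c)^2, where [c] is the mean, for a
    measure of mass 1. *)
Lemma sqr_Rintegral_le (m : probability T R) (u : T -> R) : m.-integrable setT (EFin \o u) ->
  m.-integrable setT (EFin \o (fun x => u x ^+ 2)) ->
  (\int[m]_x u x) ^+ 2 <= \int[m]_x (u x ^+ 2).
Proof.
move=> iu iu2; set c := \int[m]_x u x.
have icu : m.-integrable setT (EFin \o (fun x => (- (2 * c)) * u x)).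
  exact: RintegrableZ.
have ic : m.-integrable setT (EFin \o (fun x => c ^+ 2)) by exact: Rintegrable_cst.
have : 0 <= \int[m]_x (u x ^+ 2 + (- (2 * c) * u x + c ^+ 2)).
  apply: Rintegral_ge0 => x _.
  by have := sqr_ge0 (u x - c); rewrite (_ : (u x - c) ^+ 2 = u x ^+ 2 + (- (2 * c) * u x + c ^+ 2))//; ring.
rewrite RintegralD//; last exact: RintegrableD.
rewrite RintegralD// RintegralZl// Rintegral_cst// -/c.
have -> : fine (m setT) = 1 by rewrite (@probability_setT _ _ _ m).
rewrite mulr1.
by nra.
Qed.

Lemma nsq_cint_le (m : probability T R) f : cL2 m f -> nsq (cint m f) <= norm2 m f.
Proof.
move=> hf; have [mf jf] := hf.
have iR : m.-integrable setT (EFin \o (fun x => complex.Re (f x) ^+ 2)).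
  apply: (le_Rintegrable _ _ jf); first by apply: measurable_funX; case: mf.
  by move=> x; rewrite ger0_norm ?sqr_ge0// /nsq lerDl sqr_ge0.
have iI : m.-integrable setT (EFin \o (fun x => complex.Im (f x) ^+ 2)).
  apply: (le_Rintegrable _ _ jf); first by apply: measurable_funX; case: mf.
  by move=> x; rewrite ger0_norm ?sqr_ge0// /nsq lerDr sqr_ge0.
rewrite /norm2 /nsq RintegralD// lerD//=; apply: sqr_Rintegral_le => //.
- exact: cL2_Re.
- exact: cL2_Im.
Qed.

Lemma norm2_ge0 (m : {measure set T -> \bar R}) f : 0 <= norm2 m f.
Proof. by apply: Rintegral_ge0 => x _; exact: nsq_ge0. Qed.

Lemma norm2D_le m f g : cL2 m f -> cL2 m g ->
  norm2 m (fun x => f x + g x) <= 2 * norm2 m f + 2 * norm2 m g.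
Proof.
move=> hf hg; rewrite /norm2 -!RintegralZl//; [|by case: hg|by case: hf].
rewrite -RintegralD//; [|by apply: RintegrableZ; case: hf|by apply: RintegrableZ; case: hg].
apply: le_Rintegral => //; first by case: (cL2D hf hg).
  by apply: RintegrableD; apply: RintegrableZ; [case: hf|case: hg].
by move=> x _; exact: nsqD_le.
Qed.

Lemma norm2E (m : {measure set T -> \bar R}) f : cL2 m f ->
  ((norm2 m f)%:E = \int[m]_x (nsq (f x))%:E)%E.
Proof.
by move=> [_ jf]; rewrite /norm2 /Rintegral fineK//; exact: integrable_fin_num jf.
Qed.

End ComplexL2.

Section ComplexMixture.
Context {R : realType} {d d1 d2 : measure_display} {Y : measurableType d}
  {X1 : measurableType d1} {X2 : measurableType d2}.
Variables (mu : {measure set Y -> \bar R}) (m1 : {measure set X1 -> \bar R})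
  (m2 : {measure set X2 -> \bar R}) (phi1 : X1 -> Y) (phi2 : X2 -> Y) (a : R).
Hypotheses (mphi1 : measurable_fun setT phi1) (mphi2 : measurable_fun setT phi2).
Hypothesis a_gt0 : 0 < a.
Hypothesis muE : forall E, measurable E ->
  mu E = (a%:E * m1 (phi1 @^-1` E) + a%:E * m2 (phi2 @^-1` E))%E.

Lemma cL2_mixture (f : Y -> R[i]) : cL2 mu f ->
  cL2 m1 (f \o phi1) /\ cL2 m2 (f \o phi2).
Proof.
move=> [[mf1 mf2]] /(integrable_mixture mphi1 mphi2 a_gt0 muE)[j1 j2].
by split; split=> //; split;
  [exact: (measurableT_comp mf1)|exact: (measurableT_comp mf2)
  |exact: (measurableT_comp mf1)|exact: (measurableT_comp mf2)].
Qed.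

Lemma norm2_mixture (f : Y -> R[i]) : cL2 mu f ->
  norm2 mu f = a * norm2 m1 (f \o phi1) + a * norm2 m2 (f \o phi2).
Proof. by move=> [_ j]; rewrite /norm2 (Rintegral_mixture mphi1 mphi2 a_gt0 muE). Qed.

Lemma cint_mixture (f : Y -> R[i]) :
  mu.-integrable setT (EFin \o (fun x => complex.Re (f x))) ->
  mu.-integrable setT (EFin \o (fun x => complex.Im (f x))) ->
  cint mu f = (a%:C)%C * (cint m1 (f \o phi1) + cint m2 (f \o phi2)).
Proof.
move=> iR iI; rewrite /cint !(Rintegral_mixture mphi1 mphi2 a_gt0 muE)//.
apply: complex_ReIm => /=; first by rewrite mul0r subr0 mulrDr.
by rewrite mul0r addr0 mulrDr.
Qed.

End ComplexMixture.

(** * Density of Lipschitz functions *)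

Section LipschitzDensity.
Context {R : realType}.
Variable m : {finite_measure set R -> \bar R}.
Implicit Types (f g h : R -> R[i]) (K : R).

(** [K] bounds the square of a Lipschitz constant, in keeping with [nsq]. *)
Definition clipschitz K g := forall x y, nsq (g x - g y) <= K * (x - y) ^+ 2.

Definition lip_approx f := cL2 m f /\
  forall e : R, 0 < e -> exists g K,
    [/\ cL2 m g, clipschitz K g & norm2 m (fun x => f x - g x) <= e].

Lemma lip_approx_lip g K : cL2 m g -> clipschitz K g -> lip_approx g.
Proof.
move=> hg gK; split=> // e e0; exists g, K; split=> //.
rewrite /norm2 (_ : (fun _ => _) = fun=> 0) ?Rintegral_cst// ?mul0r ?ltW//.
by apply/funext => x; rewrite subrr nsq0.
Qed.

Lemma lip_approxD f g : lip_approx f -> lip_approx g ->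
  lip_approx (fun x => f x + g x).
Proof.
move=> [hf fa] [hg ga]; split; first exact: cL2D.
move=> e e0; have e4 : 0 < e / 4 by rewrite divr_gt0.
have [f' [K [hf' fK ef]]] := fa _ e4; have [g' [L [hg' gL eg]]] := ga _ e4.
exists (fun x => f' x + g' x), (2 * K + 2 * L); split; first exact: cL2D.
- move=> x y; rewrite opprD addrACA (le_trans (nsqD_le _ _))//.
  by rewrite [leRHS]mulrDl -!mulrA lerD// ler_pM2l.
- rewrite (_ : (fun _ => _) = fun x => (f x - f' x) + (g x - g' x)); last first.
    by apply/funext => x; rewrite opprD addrACA.
  apply: (le_trans (norm2D_le _ _)); [exact: cL2B|exact: cL2B|lra].
Qed.

Lemma lip_approxZ (c : R[i]) f : lip_approx f -> lip_approx (fun x => c * f x).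
Proof.
move=> [hf fa]; split; first exact: cL2Z.
move=> e e0; have c0 := nsq_ge0 c.
have c1 : 0 < nsq c + 1 by lra.
have [f' [K [hf' fK ef]]] := fa _ (divr_gt0 e0 c1).
exists (fun x => c * f' x), (nsq c * K); split; first exact: cL2Z.
- by move=> x y; rewrite -mulrBr nsqM -mulrA ler_wpM2l.
- rewrite /norm2 (_ : (fun _ => _) = fun x => nsq c * nsq (f x - f' x)); last first.
    by apply/funext => x; rewrite -mulrBr nsqM.
  rewrite RintegralZl//; last by case: (cL2B hf hf').
  rewrite (le_trans (ler_wpM2l c0 ef))// mulrCA ler_piMr ?ltW//.
  by rewrite ltr_pdivrMr//; lra.
Qed.

Lemma lip_approxB f g : lip_approx f -> lip_approx g ->
  lip_approx (fun x => f x - g x).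
Proof.
move=> hf /(lip_approxZ (-1)) hg; have := lip_approxD hf hg.
by congr lip_approx; apply/funext => x; rewrite mulN1r.
Qed.

Lemma lip_approx_sum (I : Type) (r : seq I) (F : I -> R -> R[i]) :
  (forall i, lip_approx (F i)) -> lip_approx (fun x => \sum_(i <- r) F i x).
Proof.
move=> hF; elim: r => [|i r ih].
  rewrite (_ : (fun _ => _) = fun=> 0); last by apply/funext => x; rewrite big_nil.
  apply: (@lip_approx_lip _ 0); first exact: cL2_cst.
  by move=> x y; rewrite subrr nsq0 mul0r.
rewrite (_ : (fun _ => _) = fun x => F i x + \sum_(j <- r) F j x).
  exact: lip_approxD.
by apply/funext => x; rewrite big_cons.
Qed.

(** Dominated convergence brings some [f_ n] within e/4 of [f], and [f_ n] has a Lipschitz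
    approximant within e/4; the triangle inequality for squared norms doubles both. Dominating the
    difference also puts [f] in L^2. *)
Lemma lip_approx_lim (f_ : nat -> R -> R[i]) f (W : R -> R) :
  (forall n, lip_approx (f_ n)) -> cmeasurable f ->
  m.-integrable setT (EFin \o W) ->
  (forall n x, nsq (f_ n x - f x) <= W x) ->
  (forall x, (fun n => nsq (f_ n x - f x)) @ \oo --> 0) ->
  lip_approx f.
Proof.
move=> af mf iW fW f0.
have mfB n : cmeasurable (fun x => f_ n x - f x).
  by apply: cmeasurableD; [case: (af n) => -[]|exact: cmeasurableN].
have hf : cL2 m f.
  have [h0 _] := af 0%N.
  apply: (@le_cL2 _ _ _ _ _ (fun x => 2 * nsq (f_ 0%N x) + 2 * W x)) => //.
    move=> x; rewrite (_ : f x = f_ 0%N x - (f_ 0%N x - f x)); last by rewrite opprB addrC subrK.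
    by rewrite (le_trans (nsqB_le _ _))// lerD2l ler_pM2l.
  by apply: RintegrableD; apply: RintegrableZ => //; case: h0.
split=> // e e0.
have [] := @dominated_convergence _ _ _ m setT measurableT
  (fun n x => (nsq (f_ n x - f x))%:E) (cst 0%E) (EFin \o W) _ _ _ iW _.
- by move=> n; apply/measurable_EFinP/measurable_nsq.
- exact: measurable_cst.
- by apply: aeW => x _; apply: cvg_EFin; [exact: nearW|exact: f0].
- by apply: aeW => x n _; rewrite gee0_abs ?lee_fin ?nsq_ge0.
move=> _ _; rewrite integral0 => cv.
have e4 : 0 < e / 4 by rewrite divr_gt0.
have [n en] : exists n, norm2 m (fun x => f_ n x - f x) <= e / 4.
  have /fine_cvgP[_ cv'] := cv; have /cvgrPdist_le/(_ _ e4)[n _ en] := cv'.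
  exists n; have := en n (leqnn n).
  by rewrite sub0r normrN; apply: le_trans; exact: ler_norm.
have [hn /(_ _ e4)[g [K [hg gK eg]]]] := af n.
exists g, K; split=> //.
rewrite (_ : (fun _ => _) = fun x => - (f_ n x - f x) + (f_ n x - g x)); last first.
  by apply/funext => x; rewrite opprB addrA subrK.
apply: (le_trans (norm2D_le _ _)); [exact/cL2N/cL2B|exact: cL2B|].
rewrite {1}/norm2 (_ : (fun x => nsq (- _)) = fun x => nsq (f_ n x - f x)); last first.
  by apply/funext => x; rewrite nsqN.
rewrite -/(norm2 m (fun x => f_ n x - f x)); lra.
Qed.
Lemma eq_lip_approx f g : f =1 g -> lip_approx f -> lip_approx g.
Proof. by move=> /funext ->. Qed.

Import HBNNSimple.

Definition cindic (E : set R) (x : R) : R[i] := (\1_E x)%:C%C.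

Lemma measurable_cindic E : measurable E -> cmeasurable (cindic E).
Proof. by move=> mE; split; [exact: measurable_indic|exact: measurable_cst]. Qed.

Definition clamp (x : R) : R := if x <= 0 then 0 else if 1 <= x then 1 else x.

Lemma clamp_lip x y : `|clamp x - clamp y| <= `|x - y|.
Proof.
wlog xy : x y / x <= y.
  move=> h; have [|/ltW] := leP x y; first exact: h.
  by move=> /h; rewrite distrC [leRHS]distrC.
rewrite distrC [leRHS]distrC [leRHS]ger0_norm ?subr_ge0// ler_norml /clamp.
by repeat case: ifPn => //; rewrite -?ltNge => *; apply/andP; split; lra.
Qed.

Lemma clamp_le1 x : 0 <= clamp x <= 1.
Proof. by rewrite /clamp; repeat case: ifPn => //; rewrite -?ltNge => *; lra. Qed.

(** The ramps clamp (n (x - a)) vanish up to [a] and equal 1 from a + 1/n on, so at each point they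
    are eventually equal to the indicator of the open ray. *)
Lemma lip_approx_ray a : lip_approx (cindic `]a, +oo[).
Proof.
pose f_ (n : nat) (x : R) : R[i] := (clamp (n%:R * (x - a)))%:C%C.
have mf n : measurable_fun setT (fun x : R => clamp (n%:R * (x - a))).
  apply: nondecreasing_measurable => // x y xy.
  have : n%:R * (x - a) <= n%:R * (y - a) by rewrite ler_wpM2l// lerD2r.
  by rewrite /clamp; repeat case: ifPn => //; rewrite -?ltNge; lra.
apply: (@lip_approx_lim f_ _ (fun=> 1)).
- move=> n; apply: (@lip_approx_lip _ (n%:R ^+ 2)).
    apply: (@le_cL2 _ _ _ _ _ (fun=> 1)); last exact: Rintegrable_cst.
      by split; [exact: mf|exact: measurable_cst].
    by move=> x; rewrite nsq_real; have := clamp_le1 (n%:R * (x - a)); nra.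
  move=> x y; rewrite /f_ -rmorphB nsq_real -exprMn.
  rewrite -(real_normK (num_real (clamp _ - _))) -(real_normK (num_real (n%:R * _))).
  rewrite ler_sqr ?nnegrE//; apply: (le_trans (clamp_lip _ _)).
  by rewrite -mulrBr opprB addrA subrK.
- by apply: measurable_cindic; exact: measurable_itv.
- exact: Rintegrable_cst.
- move=> n x; rewrite /f_ /cindic -rmorphB nsq_real indicE.
  have := clamp_le1 (n%:R * (x - a)); set c := clamp _.
  by case: (x \in _) => /=; rewrite ?mulr1n ?mulr0n; nra.
- move=> x; apply: cvg_near_cst; have [xa|ax] := leP x a.
    near=> n; rewrite /f_ /cindic -rmorphB nsq_real indicE memNset/=; last first.
      by rewrite in_itv/= andbT; apply/negP; rewrite -leNgt.
    by rewrite /clamp ifT ?subrr ?expr0n// mulr_ge0_le0// subr_le0.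
  have xa : 0 < x - a by rewrite subr_gt0.
  near=> n; rewrite /f_ /cindic -rmorphB nsq_real indicE mem_set/=; last first.
    by rewrite in_itv/= andbT.
  have n1 : 1 <= n%:R * (x - a).
    rewrite -ler_pdivrMr// mul1r; near: n; exact: nbhs_infty_ger.
  by rewrite /clamp n1 ifF ?subrr ?expr0n//; apply/negP; lra.
Unshelve. all: by end_near. Qed.

(** Dynkin's pi-lambda argument: open rays are stable under intersection and generate the Borel
    sets, while approximability passes to complements and, by dominated convergence, to countable
    disjoint unions. *)
Lemma lip_approx_cindic E : measurable E -> lip_approx (cindic E).
Proof.
have genE : @measurable _ R = <<s @RGenOInfty.G R >> := RGenOInfty.measurableE R.
rewrite [in measurable E]genE; move: E.
apply: (dynkin_induction (G := @RGenOInfty.G R)).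
- exact: genE.
- move=> _ _ [x ->] [y ->]; exists (Num.max x y); apply/seteqP; split => z /=.
    by rewrite !in_itv/= !andbT gt_max => -[-> ->].
  by rewrite !in_itv/= !andbT gt_max => /andP[].
- apply: (@eq_lip_approx (fun=> 1)).
    by move=> x; rewrite /cindic indicT.
  by apply: (@lip_approx_lip _ 0); [exact: cL2_cst|move=> x y; rewrite subrr nsq0 mul0r].
- by move=> _ [x ->]; exact: lip_approx_ray.
- move=> S mS hS; apply: (@eq_lip_approx (fun x => 1 - cindic S x)).
    by move=> x; rewrite /cindic !indicE in_setC; case: (x \in S); rewrite /= ?subrr ?subr0.
  apply: lip_approxB => //.
  by apply: (@lip_approx_lip _ 0); [exact: cL2_cst|move=> x y; rewrite subrr nsq0 mul0r].
- move=> F mF tF hF.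
  have S01 n x : \sum_(0 <= i < n) (\1_(F i) x : R) = \1_(\big[setU/set0]_(0 <= i < n) F i) x.
    elim: n => [|n ih]; first by rewrite !big_geq// indic0.
    rewrite !big_nat_recr//= ih !indicE in_setU.
    have [xn|] := boolP (x \in F n); last by rewrite orbF addr0.
    rewrite orbT memNset ?add0r//; rewrite big_mkord -bigcup_mkord => -[i /= ni Fix].
    have e : i = n by apply: tF => //; exists x; split=> //; exact: set_mem.
    by rewrite e ltnn in ni.
  apply: (@lip_approx_lim (fun n x => \sum_(0 <= i < n) cindic (F i) x) _ (fun=> 1)).
  + by move=> n; apply: lip_approx_sum.
  + by apply: measurable_cindic; exact: bigcup_measurable.
  + exact: Rintegrable_cst.
  + move=> n x; rewrite -rmorph_sum S01 /cindic -rmorphB nsq_real !indicE.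
    by case: (_ \in _); case: (_ \in _); rewrite /= ?mulr1n ?mulr0n; lra.
  + move=> x; apply: cvg_near_cst.
    have [/set_mem[k _ Fk]|xF] := boolP (x \in \bigcup_k F k); near=> n;
      rewrite -rmorph_sum S01 /cindic -rmorphB nsq_real !indicE big_mkord -bigcup_mkord.
      rewrite !mem_set ?subrr ?expr0n//; first by exists k.
      by exists k => //=; near: n; exact: nbhs_infty_gt.
    rewrite (negbTE xF) memNset ?subrr ?expr0n// => -[i _ Fi]; move/negP: xF; apply.
    by apply/mem_set; exists i.
Unshelve. all: by end_near. Qed.

(** Simple functions u_n increasing to [u] are combinations of indicators, and (u - u_n)^2 is
    dominated by u^2. *)
Lemma lip_approx_ge0 (u : R -> R) : measurable_fun setT u ->
  m.-integrable setT (EFin \o (fun x => u x ^+ 2)) -> (forall x, 0 <= u x) ->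
  lip_approx (fun x => (u x)%:C%C).
Proof.
move=> mu iu u0; have mEu : measurable_fun setT (EFin \o u) by exact/measurable_EFinP.
pose u_ := nnsfun_approx measurableT mEu.
have u_le n x : 0 <= u_ n x <= u x.
  apply/andP; split; first exact: fun_ge0.
  by rewrite -lee_fin /u_ nnsfun_approxE; apply: le_approx => // y _; rewrite lee_fin.
apply: (@lip_approx_lim (fun n x => (u_ n x)%:C%C) _ (fun x => u x ^+ 2)) => //.
- move=> n; rewrite (_ : (fun _ => _) = fun x => \sum_(y <- fset_set (range (u_ n)))
     y%:C%C * cindic (u_ n @^-1` [set y]) x); last first.
    apply/funext => x; rewrite (fimfunE (u_ n) x) fsbig_finite//= rmorph_sum/=.
    by apply: eq_bigr => y _; rewrite rmorphM.
  apply: lip_approx_sum => y; apply: lip_approxZ; apply: lip_approx_cindic.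
  exact: measurable_sfunP.
- by move=> n x; rewrite -rmorphB nsq_real; move: (u_ n x) (u x) (u_le n x) => a b /andP[a0 ab]; nra.
- move=> x.
  have : (EFin \o u_^~ x) @ \oo --> (u x)%:E.
    by apply: (@cvg_nnsfun_approx _ _ _ _ _ _ mEu) => // y _; rewrite lee_fin.
  move=> /fine_cvgP[_ ux].
  rewrite (_ : (fun _ => _) = fun n => (u_ n x - u x) * (u_ n x - u x)); last first.
    by apply/funext => n; rewrite -rmorphB nsq_real expr2.
  have d0 : u_ n x - u x @[n --> \oo] --> (0 : R).
    by rewrite -(subrr (u x)); apply: cvgB => //; exact: cvg_cst.
  by rewrite -(mulr0 0); exact: cvgM.
Qed.

Lemma lip_approx_cL2 f : cL2 m f -> lip_approx f.
Proof.
have real (u : R -> R) : measurable_fun setT u ->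
    m.-integrable setT (EFin \o (fun x => u x ^+ 2)) ->
    lip_approx (fun x => (u x)%:C%C).
  move=> mu iu.
  have le_sqr (v : R -> R) : measurable_fun setT v -> (forall x, 0 <= v x <= `|u x|) ->
      lip_approx (fun x => (v x)%:C%C).
    move=> mv vu; apply: lip_approx_ge0 => //; last by move=> x; case/andP: (vu x).
    apply: le_Rintegrable iu; first exact: measurable_funX.
    move=> x; have /andP[v0 vu'] := vu x; rewrite normrX.
    by rewrite -(real_normK (num_real (u x))) ler_sqr ?nnegrE// ger0_norm.
  apply: (@eq_lip_approx (fun x => (u^\+ x)%:C%C - (u^\- x)%:C%C)).
    by move=> x; rewrite -rmorphB -[in RHS](funrposBneg u).
  apply: lip_approxB; apply: le_sqr.
  - exact: measurable_funrpos.
  - move=> x; rewrite /funrpos le_max lexx orbT/= ge_max normr_ge0 ler_norm//.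
  - exact: measurable_funrneg.
  - move=> x; rewrite /funrneg le_max lexx orbT/= ge_max normr_ge0 -normrN ler_norm//.
move=> [[mR mI] jf].
apply: (@eq_lip_approx (fun x => (complex.Re (f x))%:C%C + 'i%C * (complex.Im (f x))%:C%C)).
  by move=> x; case: (f x) => a b; apply: complex_ReIm => /=; ring.
apply: lip_approxD; last apply: lip_approxZ.
- apply: real => //; apply: le_Rintegrable jf; first exact: measurable_funX.
  by move=> x; rewrite ger0_norm ?sqr_ge0// /nsq lerDl sqr_ge0.
- apply: real => //; apply: le_Rintegrable jf; first exact: measurable_funX.
  by move=> x; rewrite ger0_norm ?sqr_ge0// /nsq lerDr sqr_ge0.
Qed.

End LipschitzDensity.

(** * Self-similar measures *)

Section Exponentials.
Context {R : realType}.
Implicit Types a b t x : R.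

Definition ech a : R[i] := cos (2 * pi * a) +i* sin (2 * pi * a).

Lemma echD a b : ech (a + b) = ech a * ech b.
Proof.
rewrite /ech mulrDr cosD sinD; apply: complex_ReIm => //=.
by rewrite addrC.
Qed.

Lemma ech0 : ech 0 = 1.
Proof. by rewrite /ech mulr0 cos0 sin0. Qed.

Lemma nsq_ech a : nsq (ech a) = 1.
Proof. by rewrite /nsq /= cos2Dsin2. Qed.

Lemma ech_half : ech 2^-1 = -1.
Proof.
rewrite /ech mulrAC mulfV ?pnatr_eq0// mul1r cospi sinpi.
by apply: complex_ReIm => //=; rewrite oppr0.
Qed.

Lemma ech_nat (n : nat) : ech n%:R = 1.
Proof.
have ech1 : ech 1 = 1 by rewrite (_ : 1 = 2^-1 + 2^-1) ?echD ?ech_half ?mulrNN ?mulr1//; lra.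
elim: n => [|n ih]; first exact: ech0.
by rewrite -addn1 natrD echD ih ech1 mulr1.
Qed.

Lemma measurable_ech t : cmeasurable (fun x : R => ech (t * x)).
Proof.
split; rewrite /ech /=.
- apply: (measurableT_comp (f := @cos R)) => //.
    by apply: continuous_measurable_fun; exact: continuous_cos.
  by apply: measurable_funM => //; apply: measurable_funM.
- apply: (measurableT_comp (f := @sin R)) => //.
    by apply: continuous_measurable_fun; exact: continuous_sin.
  by apply: measurable_funM => //; apply: measurable_funM.
Qed.

Lemma cL2_ech (m : {finite_measure set R -> \bar R}) f t :
  cL2 m f -> cL2 m (fun x => f x * ech (t * x)).
Proof.
by move=> hf; apply: cL2M1 => //; [exact: measurable_ech|move=> x; rewrite nsq_ech].
Qed.

End Exponentials.

Section FourierTransform.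
Context {R : realType}.
Implicit Types (m : probability R R).

Definition ft m (f : R -> R[i]) (t : R) : R[i] := cint m (fun x => f x * ech (t * x)).

Lemma ft_le m f t : cL2 m f -> nsq (ft m f t) <= norm2 m f.
Proof.
move=> hf; apply: (le_trans (nsq_cint_le (cL2_ech t hf))).
rewrite /norm2 le_eqVlt; apply/orP; left; apply/eqP/eq_Rintegral => x _.
by rewrite nsqM nsq_ech mulr1.
Qed.

Lemma ftB m f g t : cL2 m f -> cL2 m g ->
  ft m (fun x => f x - g x) t = ft m f t - ft m g t.
Proof.
move=> hf hg; rewrite /ft -cintB; [|exact: cL2_ech|exact: cL2_ech].
by apply: eq_cint => x; rewrite mulrBl.
Qed.

End FourierTransform.

(** * A Cantor measure as a self-similar mixture, and its support *)

Section CantorMeasure.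
Context {R : realType}.
Variables (N : nat) (mu : probability R R).
Hypotheses (N_ge4 : (4 <= N)%N) (hmu : cantor_measure N mu).

Local Notation Nr := (N%:R : R).

Definition digit (b : bool) (x : R) : R := (x + b%:R) / Nr.

Let N_gt0 : 0 < Nr. Proof. by rewrite ltr0n; lia. Qed.
Let Nr_ge4 : 4 <= Nr. Proof. by rewrite (ler_nat R 4 N). Qed.
Let half_gt0 : 0 < (2^-1 : R). Proof. by rewrite invr_gt0. Qed.

Lemma measurable_digit b : measurable_fun setT (digit b).
Proof. by apply: measurable_funM => //; apply: measurable_funD. Qed.

(** The sets N E and N E - 1 of the defining equation are the preimages of [E] under x/N and (x +
    1)/N, so [mu] is the average of its images under two contractions. *)
Lemma cantor_mixture E : measurable E ->
  mu E = ((2^-1)%:E * mu (digit false @^-1` E) + (2^-1)%:E * mu (digit true @^-1` E))%E.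
Proof.
move=> mE; rewrite hmu//; congr (_ * mu _ + _ * mu _)%E; apply/seteqP; split => x /=.
- by move=> [y Ey <-]; rewrite /digit addr0 mulrAC mulfV ?mul1r ?gt_eqF.
- move=> Ex; exists (digit false x) => //.
  by rewrite /digit addr0 mulrCA mulfV ?mulr1 ?gt_eqF.
- by move=> [y Ey <-]; rewrite /digit subrK mulrAC mulfV ?mul1r ?gt_eqF.
- move=> Ex; exists (digit true x) => //.
  by rewrite /digit mulrCA mulfV ?mulr1 ?addrK ?gt_eqF.
Qed.

Lemma cL2_digit f : cL2 mu f ->
  cL2 mu (f \o digit false) /\ cL2 mu (f \o digit true).
Proof.
exact: (cL2_mixture (measurable_digit false) (measurable_digit true)
  half_gt0 cantor_mixture).
Qed.

Lemma norm2_digit f : cL2 mu f ->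
  norm2 mu f = 2^-1 * norm2 mu (f \o digit false) + 2^-1 * norm2 mu (f \o digit true).
Proof.
exact: (norm2_mixture (measurable_digit false) (measurable_digit true)
  half_gt0 cantor_mixture).
Qed.

Lemma cint_digit f : cL2 mu f -> cint mu f =
  (2^-1)%:C%C * (cint mu (f \o digit false) + cint mu (f \o digit true)).
Proof.
move=> hf; apply: (cint_mixture (measurable_digit false) (measurable_digit true)
  half_gt0 cantor_mixture); [exact: cL2_Re|exact: cL2_Im].
Qed.

Definition outside (s : R) : set R := [set x | s < `|x|].

Lemma measurable_outside s : measurable (outside s).
Proof.
have := @measurable_fun_ltr _ _ _ setT (fun=> s) (fun x : R => `|x|)
  (@measurable_cst _ _ _ _ _ _) (@normr_measurable R setT).
move=> /(_ measurableT [set true]); rewrite setTI => h.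
rewrite (_ : outside s = (fun x : R => s < `|x|) @^-1` [set true]); first exact: h.
by apply/seteqP; split => x.
Qed.

Let le_measure_prob A B : measurable A -> measurable B -> A `<=` B ->
  (mu A <= mu B)%E.
Proof. by move=> mA mB AB; apply: le_measure => //; exact: mem_set. Qed.

Lemma cantor_outside_step s : (mu (outside s) <= mu (outside (Nr * s - 1)))%E.
Proof.
rewrite cantor_mixture; last exact: measurable_outside.
have sub b : digit b @^-1` outside s `<=` outside (Nr * s - 1).
  move=> x; rewrite /outside /digit /= normf_div (ger0_norm (ltW N_gt0)).
  rewrite ltr_pdivlMr// mulrC => h.
  have : `|x + b%:R| <= `|x| + 1.
    by rewrite (le_trans (ler_normD _ _))// lerD2l; case: b {h}; rewrite ?normr0 ?normr1.
  lra.
have mb b : measurable (digit b @^-1` outside s).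
  by rewrite -[X in measurable X]setTI; apply: measurable_digit => //; exact: measurable_outside.
set q := mu (outside (Nr * s - 1)).
have -> : q = ((2^-1)%:E * q + (2^-1)%:E * q)%E.
  have h2 : 2^-1 + 2^-1 = 1 :> R by lra.
  by rewrite -ge0_muleDl ?lee_fin ?ltW// -EFinD h2 mul1e.
by apply: leeD; rewrite lee_pmul2l ?lte_fin//;
  apply: le_measure_prob => //; exact: measurable_outside.
Qed.

(** For s > 1/(N - 1), iterating s -> N s - 1 moves to the right by at least [e] each time without
    decreasing the mass of the tail; the tails shrink to the empty set, so that mass is 0. *)
Lemma cantor_supp s : 1 < (Nr - 1) * s -> mu (outside s) = 0%E.
Proof.
move=> s1; pose e := (Nr - 1) * s - 1.
have e0 : 0 < e by rewrite subr_gt0.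
have outS r r' : r <= r' -> (mu (outside r') <= mu (outside r))%E.
  move=> rr; apply: le_measure_prob; try exact: measurable_outside.
  by move=> x; rewrite /outside /=; exact: le_lt_trans.
have le_n n : (mu (outside s) <= mu (outside (s + n%:R * e)))%E.
  elim: n => [|n ih]; first by rewrite mul0r addr0.
  apply: (le_trans ih); apply: (le_trans (cantor_outside_step _)); apply: outS.
  rewrite -natr1 mulrDl mul1r addrA.
  have n0 : 0 <= n%:R * e by rewrite mulr_ge0// ltW.
  rewrite /e in n0 *; have := Nr_ge4; move: (n%:R * _) n0 => z z0; nra.
have cv : mu (outside (s + n%:R * e)) @[n --> \oo] --> mu set0.
  rewrite (_ : set0 = \bigcap_n outside (s + n%:R * e)); last first.
    apply/esym/seteqP; split => // x /= hx.
    have [n _ hn] : \forall n \near \oo, (`|x| - s) / e <= n%:R by exact: nbhs_infty_ger.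
    have := hx n I; rewrite /outside /= ltNge => /negP; apply.
    by rewrite -lerBlDl -ler_pdivrMr//; apply: hn => /=.
  apply: nonincreasing_cvg_mu => //.
  - by rewrite (le_lt_trans (probability_le1 _ _)) ?ltry//; exact: measurable_outside.
  - by move=> n; exact: measurable_outside.
  - by apply: bigcap_measurable => // n _; exact: measurable_outside.
  - move=> n p np; apply/subsetPset => x; rewrite /outside /=; apply: le_lt_trans.
    by rewrite lerD2l ler_wpM2r ?ler_nat// ltW.
apply/eqP; rewrite eq_le measure_ge0 andbT.
rewrite measure0 in cv; rewrite -[leRHS](cvg_lim _ cv)//; apply: lime_ge; first by apply/cvg_ex; eexists; exact: cv.
exact: nearW.
Qed.

Lemma le_Rintegral_supp s (u v : R -> R) : 1 < (Nr - 1) * s ->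
  mu.-integrable setT (EFin \o u) -> mu.-integrable setT (EFin \o v) ->
  (forall x, `|x| <= s -> u x <= v x) -> \int[mu]_x u x <= \int[mu]_x v x.
Proof.
move=> s1 iu iv uv; have mo := measurable_outside s.
rewrite /Rintegral (negligible_integral mo measurableT iu (cantor_supp s1)).
rewrite (negligible_integral mo measurableT iv (cantor_supp s1)).
have mD : measurable (setT `\` outside s) by exact: measurableD.
apply: le_Rintegral => //; try by apply: integrableS (subsetT _) _.
by move=> x [_ /= /negP]; rewrite -leNgt; exact: uv.
Qed.

End CantorMeasure.

(** * The spectrum and the Bessel inequality *)

Section CantorSpectrum.
Context {R : realType}.
Variables (M : nat) (mu : probability R R).
Local Notation N := (M.*2).
Hypotheses (M_ge2 : (2 <= M)%N) (hmu : cantor_measure N mu).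

Local Notation Nr := (N%:R : R).

Let N_ge4 : (4 <= N)%N. Proof. by lia. Qed.
Let N_gt0 : 0 < Nr. Proof. by rewrite ltr0n; lia. Qed.
Let Nr_ge4 : 4 <= Nr. Proof. by rewrite (ler_nat R 4 N). Qed.

(* [spread] reads the binary digits of its argument in base N; the first argument
   of [spread_fuel] only bounds the number of digits. *)
Fixpoint spread_fuel (n k : nat) : nat :=
  if n is n'.+1 then (odd k + N * spread_fuel n' k./2)%N else 0%N.

Definition spread (k : nat) : nat := spread_fuel k k.

Lemma spread_fuelE n k : (k <= n)%N -> spread_fuel n k = spread k.
Proof.
have fuel0 p : spread_fuel p 0 = 0%N by elim: p => //= p ->; rewrite muln0.
rewrite /spread; elim/ltn_ind: k n => -[|k] ih [|n] //= kn.
  by rewrite fuel0 muln0.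
have kk : (uphalf k <= k)%N by rewrite leq_uphalf_double -addnn leq_addr.
congr (_ + _ * _)%N; rewrite (ih (uphalf k)) ?ltnS//; last first.
  by rewrite (leq_trans kk).
by rewrite (ih (uphalf k) _ k) ?ltnS.
Qed.

Lemma spread_double (b : bool) k : spread (b + k.*2) = (b + N * spread k)%N.
Proof.
rewrite -(@spread_fuelE (b + k.*2).+1)//=.
rewrite oddD odd_double addbF oddb half_bit_double.
by rewrite spread_fuelE//; lia.
Qed.

(** [N] is even, so parity recovers the lowest binary digit, and strong induction on the half
    recovers the others. *)
Lemma spread_inj : injective spread.
Proof.
move=> k; elim/ltn_ind: k => k ih k'.
rewrite -(odd_double_half k) -(odd_double_half k') !spread_double => e.
have odd_eq : odd k = odd k'.
  have := congr1 odd e; rewrite !oddD !oddM !odd_double !oddb.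
  by rewrite !andFb !addbF.
rewrite odd_eq in e *; congr (_ + _.*2)%N.
(* Halving does not decrease 0, so k = 0 is treated apart: [spread] is positive at positive
   arguments. *)
have [k0|k0] := posnP k; last first.
  apply: ih; first by rewrite ltn_half_double; lia.
  by move: e => /addnI/eqP; rewrite eqn_pmul2l; [move/eqP|lia].
move: e odd_eq; rewrite k0 /= => /addnI/eqP; rewrite muln0 eq_sym muln_eq0.
move=> /orP[|]; first by lia.
move: k'./2 => [|j]//; rewrite /spread /=.
have : (0 < spread j.+1)%N.
  elim/ltn_ind: j => j ihj; rewrite -(odd_double_half j.+1) spread_double.
  have [odj|] := boolP (odd j.+1); first by lia.
  move=> ev; rewrite add0n muln_gt0; apply/andP; split; first by lia.
  case: j ihj ev => [//|j] ihj ev; have := ihj (j./2).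
  by rewrite /= => ->//; lia.
by rewrite /spread /=; lia.
Qed.

(** Since M = N/2, these are the finite sums of distinct numbers M N^j: up to scaling, the spectrum
    of Jorgensen and Pedersen for N = 4. *)
Definition freq (k : nat) : R := (M * spread k)%:R.

Lemma freq_inj : injective freq.
Proof.
move=> k k' /eqP; rewrite eqr_nat => /eqP e; apply: spread_inj.
by apply/eqP; move/eqP: e; rewrite eqn_pmul2l//; lia.
Qed.

Lemma sum_pow2S (V : nmodType) (G : nat -> V) n :
  \sum_(0 <= k < 2 ^ n.+1) G k =
  \sum_(0 <= k < 2 ^ n) G k.*2 + \sum_(0 <= k < 2 ^ n) G k.*2.+1.
Proof.
rewrite expnS mul2n; elim: (2 ^ n)%N => [|m ih].
  by rewrite !big_geq// addr0.
by rewrite doubleS !big_nat_recr//= ih -!addrA; congr (_ + _); rewrite addrCA addrA.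
Qed.

(* The adjoint Cuntz isometries: |f^|^2 summed over the first 2^(n+1) frequencies
   is |(branch b f)^|^2 summed over the first 2^n frequencies and over b. *)
Definition branch (b : bool) (f : R -> R[i]) (x : R) : R[i] :=
  2^-1%:C%C * ech (b%:R / 2 * x) *
  (f (digit N false x) + (-1) ^+ b * f (digit N true x)).

Lemma cL2_branch b f : cL2 mu f -> cL2 mu (branch b f).
Proof.
move=> /(cL2_digit N_ge4 hmu)[h0 h1].
rewrite (_ : branch b f = fun x => 2^-1%:C%C * ((f (digit N false x) +
  (-1) ^+ b * f (digit N true x)) * ech (b%:R / 2 * x))); last first.
  by apply/funext => x; rewrite /branch; ring.
by apply: cL2Z; apply: cL2_ech; apply: cL2D => //; exact: cL2Z.
Qed.

(** The phase in [branch] has modulus 1, and the parallelogram law gives |(u + v)/2|^2 + |(u -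
    v)/2|^2 = (|u|^2 + |v|^2)/2 for the two halves of [f]. *)
Lemma norm2_branch f : cL2 mu f ->
  norm2 mu (branch false f) + norm2 mu (branch true f) = norm2 mu f.
Proof.
move=> hf; have [h0 h1] := cL2_digit N_ge4 hmu hf.
have [hb0 hb1] := (cL2_branch false hf, cL2_branch true hf).
rewrite (norm2_digit N_ge4 hmu hf) /norm2 -RintegralD//; [|by case: hb0|by case: hb1].
rewrite -!RintegralZl//; [|by case: h1|by case: h0].
rewrite -RintegralD//; [|by apply: RintegrableZ; case: h0|by apply: RintegrableZ; case: h1].
apply: eq_Rintegral => x _; rewrite /branch !nsqM !nsq_ech nsq_real expr0 expr1 mul1r mulN1r.
by have := nsq_parallelogram (f (digit N false x)) (f (digit N true x)) => /= h; lra.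
Qed.

(** The frequency divided by [N] is freq k + b/2. On the half with digit [d] this yields the phase
    of [branch b], an integer that [ech] ignores, and b d/2, which is the sign (-1)^(b d). *)
Lemma ft_branch (b : bool) f k : cL2 mu f ->
  ft mu f (freq (b + k.*2)) = ft mu (branch b f) (freq k).
Proof.
move=> hf; rewrite /ft (cint_digit N_ge4 hmu); last exact: cL2_ech.
have [h0 h1] := cL2_digit N_ge4 hmu (cL2_ech (freq (b + k.*2)) hf).
rewrite -cintD// -cintZ; last exact: cL2D.
apply: eq_cint => x /=; rewrite /branch.
have M0 : (M%:R : R) != 0 by rewrite pnatr_eq0; lia.
have arg (d : bool) : freq (b + k.*2) * digit N d x =
    b%:R / 2 * x + (freq k * x + ((M * spread k * d)%:R + (b * d)%:R / 2)).
  by rewrite /freq spread_double /digit -mul2n !(natrM, natrD); field.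
have e0 : ech (freq (b + k.*2) * digit N false x) = ech (b%:R / 2 * x) * ech (freq k * x).
  by rewrite arg !muln0 mul0r !addr0 echD.
have e1 : ech (freq (b + k.*2) * digit N true x) =
    ech (b%:R / 2 * x) * (ech (freq k * x) * (-1) ^+ b).
  rewrite arg !muln1 (echD (b%:R / 2 * x)) (echD (freq k * x)) echD ech_nat mul1r.
  congr (_ * (_ * _)); case: b {arg e0 h0 h1}; last by rewrite mul0r ech0.
  by rewrite mul1r ech_half expr1.
by rewrite e0 e1; ring.
Qed.

Lemma freq0 : freq 0 = 0.
Proof. by rewrite /freq /spread muln0. Qed.

(** Each step strips the lowest binary digit of [k] by passing to a branch; the norms of the
    branches add up exactly, and a single frequency is left at the end. *)
Lemma bessel_pow2 n f : cL2 mu f ->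
  \sum_(0 <= k < 2 ^ n) nsq (ft mu f (freq k)) <= norm2 mu f.
Proof.
elim: n f => [|n ih] f hf; first by rewrite big_nat1; exact: ft_le.
rewrite sum_pow2S -norm2_branch//; apply: lerD.
- rewrite (eq_bigr (fun k => nsq (ft mu (branch false f) (freq k)))).
    exact/ih/cL2_branch.
  by move=> k _; rewrite -(ft_branch false).
- rewrite (eq_bigr (fun k => nsq (ft mu (branch true f) (freq k)))).
    exact/ih/cL2_branch.
  by move=> k _; rewrite -(ft_branch true).
Qed.

Lemma bessel n f : cL2 mu f ->
  \sum_(0 <= k < n) nsq (ft mu f (freq k)) <= norm2 mu f.
Proof.
move=> hf; apply: le_trans (bessel_pow2 n hf).
rewrite [leRHS](big_cat_nat (n := n))//=; last exact/ltnW/ltn_expl.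
by rewrite lerDl sumr_ge0// => k _; exact: nsq_ge0.
Qed.

End CantorSpectrum.

(** * The lower frame bound *)

Section CantorLowerBound.
Context {R : realType}.

(* 7/15 = 2 (2/3) (7/20), where |t| <= 2/3 for the frequencies met at the end of the
   cascade and |x| <= 7/20 almost everywhere. *)
Definition cosc : R := cos (7 / 15 * pi).

Lemma cosc_gt0 : 0 < cosc.
Proof. by apply: cos_gt0_pihalf; have := pi_gt0 R => p; apply/andP; split; lra. Qed.

Lemma cosc_le1 : cosc <= 1. Proof. exact: cos_le1. Qed.

Lemma cosc_le (t x : R) : `|t| <= 2 / 3 -> `|x| <= 7 / 20 -> cosc <= cos (2 * pi * (t * x)).
Proof.
move=> t1 x1; have p := pi_gt0 R.
rewrite -(cos_norm (2 * pi * _)) leNgt ltr_cos ?in_itv/=.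
- rewrite -leNgt !normrM (ger0_norm (ltW p)) ger0_norm//.
  have : `|t| * `|x| <= 2 / 3 * (7 / 20) by apply: ler_pM.
  by move: (`|t| * `|x|) => z z1; nra.
- by apply/andP; split; lra.
- rewrite normr_ge0/= !normrM (ger0_norm (ltW p)) ger0_norm//.
  have : `|t| * `|x| <= 2 / 3 * (7 / 20) by apply: ler_pM.
  by move: (`|t| * `|x|) => z z1; nra.
Qed.

Variables (M : nat) (mu : probability R R).
Local Notation N := (M.*2).
Hypotheses (M_ge2 : (2 <= M)%N) (hmu : cantor_measure N mu).

Local Notation Nr := (N%:R : R).
Local Notation c1 := (cosc ^+ 2 / 4).

Let N_ge4 : (4 <= N)%N. Proof. by lia. Qed.
Let N_gt0 : 0 < Nr. Proof. by rewrite ltr0n; lia. Qed.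
Let Nr_ge4 : 4 <= Nr. Proof. by rewrite (ler_nat R 4 N). Qed.
Let supp : 1 < (Nr - 1) * (7 / 20).
Proof. by have := Nr_ge4; move: Nr => z; lra. Qed.

Lemma ft1_ge (t : R) : `|t| <= 2 / 3 -> cosc ^+ 2 <= nsq (ft mu (fun=> 1) t).
Proof.
move=> t1; have h1 : cL2 mu (fun x => 1 * ech (t * x)).
  by apply: cL2_ech; exact: cL2_cst.
suff : cosc <= complex.Re (ft mu (fun=> 1) t).
  by have := cosc_gt0; rewrite /nsq; set a := complex.Re _; set b := complex.Im _; nra.
have -> : cosc = \int[mu]_x cosc.
  by rewrite Rintegral_cst// (_ : fine (mu setT) = 1) ?mulr1// (@probability_setT _ _ _ mu).
apply: (le_Rintegral_supp N_ge4 hmu supp); [exact: Rintegrable_cst|exact: (cL2_Re h1)|].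
by move=> x x1 /=; rewrite mul1r mul0r subr0; exact: cosc_le.
Qed.

Lemma clipschitz_ge0 K (h : R -> R[i]) : clipschitz K h -> 0 <= K.
Proof.
by move=> /(_ 1 0); rewrite subr0 expr1n mulr1; apply: le_trans; exact: nsq_ge0.
Qed.

(** On the support |h - h(0)|^2 <= K, and [ft1_ge] controls the transform of the constant h(0). The
    factor 1/4 in [c1] comes from two uses of |u + v|^2 <= 2|u|^2 + 2|v|^2. *)
Lemma ft_lip_ge (h : R -> R[i]) K t : cL2 mu h -> clipschitz K h -> `|t| <= 2 / 3 ->
  c1 * norm2 mu h - 2 * K <= nsq (ft mu h t).
Proof.
move=> hh hK t1; have K0 := clipschitz_ge0 hK.
pose a : R[i] := h 0; pose g x := h x - a.
have ha : cL2 mu (fun=> a) by exact: cL2_cst.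
have hg : cL2 mu g by exact: cL2B.
have gK : norm2 mu g <= K.
  have -> : K = \int[mu]_x K.
    by rewrite Rintegral_cst// (_ : fine (mu setT) = 1) ?mulr1// (@probability_setT _ _ _ mu).
  apply: (le_Rintegral_supp N_ge4 hmu supp); [by case: hg|exact: Rintegrable_cst|].
  move=> x x1; apply: (le_trans (hK x 0)); rewrite subr0 ler_piMr//.
  by rewrite -(real_normK (num_real x)) expr_le1//; lra.
have na : norm2 mu (fun=> a) = nsq a.
  rewrite /norm2 Rintegral_cst// (_ : fine (mu setT) = 1) ?mulr1//.
  by rewrite (@probability_setT _ _ _ mu).
have hle : norm2 mu h <= 2 * nsq a + 2 * K.
  have -> : h = fun x => a + g x by apply/funext => x; rewrite /g addrC subrK.
  by rewrite (le_trans (norm2D_le ha hg))// na lerD2l ler_pM2l.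
have ft1 : nsq (a * ft mu (fun=> 1) t) <= 2 * nsq (ft mu h t) + 2 * K.
  have -> : a * ft mu (fun=> 1) t = ft mu h t - ft mu g t.
    rewrite -ftB// /ft -cintZ; last by apply: cL2_ech; exact: cL2_cst.
    by apply: eq_cint => x; rewrite /g; ring.
  by rewrite (le_trans (nsqB_le _ _))// lerD2l ler_pM2l// (le_trans (ft_le _ hg)).
rewrite nsqM in ft1.
have ft2 : nsq a * cosc ^+ 2 <= nsq a * nsq (ft mu (fun=> 1) t).
  by rewrite ler_wpM2l ?nsq_ge0// ft1_ge.
have cc : cosc ^+ 2 <= 1 by rewrite expr_le1// ?cosc_le1// ltW// cosc_gt0.
have c0 : 0 <= cosc ^+ 2 by rewrite sqr_ge0.
have cK : cosc ^+ 2 * K <= K by rewrite ler_piMl.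
have ch := ler_wpM2l c0 hle.
move: (cosc ^+ 2) (nsq a) (nsq (ft _ _ _)) (norm2 mu h) cc c0 cK ch ft1 ft2 => c na' F n2.
nra.
Qed.

(** The amplitude of a branch of h(x) e^(2 pi i t x) once the oscillating factor of frequency t/N +
    b/2 is taken out. That factor would spoil the Lipschitz bound, whereas the amplitude flattens at
    each level. *)
Definition lip_branch (b : bool) (t : R) (h : R -> R[i]) (x : R) : R[i] :=
  2^-1%:C%C * (h (digit N false x) + (-1) ^+ b * ech (t / Nr) * h (digit N true x)).

Lemma branch_lip b t h : branch M b (fun x => h x * ech (t * x)) =
  fun x => lip_branch b t h x * ech ((t / Nr + b%:R / 2) * x).
Proof.
apply/funext => x; rewrite /branch /lip_branch.
have -> : ech (t * digit N false x) = ech (t / Nr * x).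
  by congr ech; rewrite /digit addr0 mulrA mulrAC.
have -> : ech (t * digit N true x) = ech (t / Nr) * ech (t / Nr * x).
  by rewrite -echD; congr ech; rewrite /digit mulrA mulrAC mulrDr mulr1 addrC.
rewrite mulrDl echD; ring.
Qed.

Lemma cL2_lip_branch b t h : cL2 mu h -> cL2 mu (lip_branch b t h).
Proof.
move=> /(cL2_digit N_ge4 hmu)[h0 h1].
by apply: cL2Z; apply: cL2D => //; exact: cL2Z.
Qed.

(** Each digit map divides squared increments by N^2, and averaging two terms with unimodular
    coefficients does not increase the bound. *)
Lemma clipschitz_branch b t h K : clipschitz K h ->
  clipschitz (K / Nr ^+ 2) (lip_branch b t h).
Proof.
move=> hK x y; rewrite /lip_branch -mulrBr nsqM nsq_real opprD addrACA -mulrBr.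
set p := h (digit N false x) - _; set q := h (digit N true x) - _.
have dK (d : bool) : nsq (h (digit N d x) - h (digit N d y)) <= K / Nr ^+ 2 * (x - y) ^+ 2.
  apply: (le_trans (hK _ _)); rewrite le_eqVlt; apply/orP; left; apply/eqP.
  by rewrite /digit; field; rewrite gt_eqF.
have := nsqD_le p ((-1) ^+ b * ech (t / Nr) * q).
have b1 : nsq ((-1) ^+ b : R[i]) = 1.
  by case: b; rewrite ?expr1 ?expr0 ?nsqN nsq1.
rewrite !nsqM b1 nsq_ech !mul1r => h1; have := dK false; have := dK true.
rewrite -/p -/q; move: (K / _ * _) (nsq p) (nsq q) (nsq (p + _)) h1 => *.
lra.
Qed.

Lemma norm2_ech h t : norm2 mu (fun x => h x * ech (t * x)) = norm2 mu h.
Proof. by apply: eq_Rintegral => x _; rewrite nsqM nsq_ech mulr1. Qed.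

(** After n levels there are 2^n branches, each with Lipschitz bound K/N^(2n), whence the error
    (2/N^2)^n K; the squared norms of the branches add up exactly. *)
Lemma lip_lower_bound n h t K : cL2 mu h -> clipschitz K h -> 0 <= t <= 2 / 3 ->
  c1 * norm2 mu h - 2 * ((2 / Nr ^+ 2) ^+ n * K) <=
  \sum_(0 <= k < 2 ^ n) nsq (ft mu (fun x => h x * ech (t * x)) (freq M k)).
Proof.
elim: n h t K => [|n ih] h t K hh hK /andP[t0 t1].
  rewrite big_nat1 expr0 mul1r freq0 (_ : ft _ _ 0 = ft mu h t).
    by apply: ft_lip_ge => //; rewrite ger0_norm.
  by apply: eq_cint => x; rewrite mul0r ech0 mulr1.
have hht : cL2 mu (fun x => h x * ech (t * x)) by exact: cL2_ech.
have step b : c1 * norm2 mu (branch M b (fun x => h x * ech (t * x))) -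
    2 * ((2 / Nr ^+ 2) ^+ n * (K / Nr ^+ 2)) <=
    \sum_(0 <= k < 2 ^ n) nsq (ft mu (fun x => h x * ech (t * x)) (freq M (b + k.*2))).
  rewrite (eq_bigr (fun k => nsq (ft mu (branch M b (fun x => h x * ech (t * x))) (freq M k)))); last first.
    by move=> k _; rewrite (ft_branch M_ge2 hmu).
  rewrite branch_lip norm2_ech; apply: ih.
  - exact: cL2_lip_branch.
  - exact: clipschitz_branch.
  (* 2/3 is the fixed point of t/4 + 1/2, so [0, 2/3] is stable under t -> t/N + b/2 when N >= 4. *)
  - have t4 : 0 <= t / Nr <= 1 / 6.
      by rewrite divr_ge0//= ler_pdivrMr//; have := Nr_ge4; move: Nr => z; lra.
    by move: (t / Nr) t4 => z; case: b => /=; rewrite ?mul0r ?mul1r; lra.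
rewrite sum_pow2S -(norm2_ech h t) -(norm2_branch M_ge2 hmu hht).
apply: le_trans (lerD (step false) (step true)).
rewrite (exprSr _ n) le_eqVlt; apply/orP; left; apply/eqP.
move: (norm2 _ _) (norm2 _ _) ((2 / Nr ^+ 2) ^+ n) Nr N_gt0 => u v p z z0.
by field; rewrite gt_eqF.
Qed.

(** [bessel_pow2] bounds the coefficients of f - g for a Lipschitz approximant [g], so the bound for
    [g] passes to [f]. Doubling once for the coefficients and once for the norms turns 1/4 into
    1/16. *)
Lemma frame_lower_bound f (e : R) : cL2 mu f -> 0 < e ->
  exists n, cosc ^+ 2 / 16 * norm2 mu f - e <=
  \sum_(0 <= k < n) nsq (ft mu f (freq M k)).
Proof.
move=> hf e0; have [_ fa] := lip_approx_cL2 hf.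
have e4 : 0 < e / 4 by lra.
have [g [K [hg gK eg]]] := fa _ e4; have K0 := clipschitz_ge0 gK.
have [n hn] : exists n, (2 / Nr ^+ 2) ^+ n * K <= e / 4.
  have [n _ nK] : \forall n \near \oo, K / (e / 4) <= n%:R by exact: nbhs_infty_ger.
  exists n; have {}nK := nK n (leqnn n); rewrite ler_pdivrMr// in nK.
  have r0 : 0 <= 2 / Nr ^+ 2 by rewrite divr_ge0// sqr_ge0.
  have r2 : 2 / Nr ^+ 2 <= 2^-1.
    by rewrite ler_pdivrMr ?exprn_gt0//; have := Nr_ge4; nra.
  have rn : (2 / Nr ^+ 2) ^+ n <= 2^-1 ^+ n by rewrite lerXn2r// nnegrE.
  apply: (le_trans (ler_wpM2r K0 rn)).
  have n2 : n%:R <= 2 ^+ n :> R by rewrite -natrX ler_nat ltnW// ltn_expl.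
  have p2 : 0 < 2 ^+ n :> R by rewrite exprn_gt0.
  rewrite exprVn mulrC ler_pdivrMr// mulrC; apply: (le_trans nK).
  by rewrite ler_wpM2r// ltW.
exists (2 ^ n)%N.
have := @lip_lower_bound n g 0 K hg gK; rewrite lexx divr_ge0// => /(_ isT).
rewrite (_ : (fun x => g x * ech (0 * x)) = g); last first.
  by apply/funext => x; rewrite mul0r ech0 mulr1.
have hfg : cL2 mu (fun x => f x - g x) by exact: cL2B.
have Bd := bessel_pow2 M_ge2 hmu n hfg.
have le_fg : \sum_(0 <= k < 2 ^ n) nsq (ft mu g (freq M k)) <=
    2 * \sum_(0 <= k < 2 ^ n) nsq (ft mu f (freq M k)) +
    2 * \sum_(0 <= k < 2 ^ n) nsq (ft mu (fun x => f x - g x) (freq M k)).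
  rewrite !big_distrr -big_split /=; apply: ler_sum => k _.
  have -> : ft mu g (freq M k) = ft mu f (freq M k) - ft mu (fun x => f x - g x) (freq M k).
    by rewrite ftB// opprB addrC subrK.
  exact: nsqB_le.
have fg : norm2 mu f <= 2 * norm2 mu g + 2 * norm2 mu (fun x => f x - g x).
  rewrite {1}(_ : f = fun x => g x + (f x - g x)); first exact: norm2D_le.
  by apply/funext => x; rewrite addrC subrK.
have cc : cosc ^+ 2 <= 1 by rewrite expr_le1// ?cosc_le1// ltW// cosc_gt0.
have c0 : 0 <= cosc ^+ 2 by rewrite sqr_ge0.
have cfg := ler_wpM2l c0 fg.
have ng := norm2_ge0 mu (fun x => f x - g x).
have cng : cosc ^+ 2 * norm2 mu (fun x => f x - g x) <= norm2 mu (fun x => f x - g x).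
  by rewrite ler_piMl.
move: (cosc ^+ 2) (norm2 mu _) (norm2 mu g) (norm2 mu f) (\sum_(_ <= _ < _) _)
  (\sum_(_ <= _ < _) _) (\sum_(_ <= _ < _) _) ((2 / _) ^+ n * K) cc c0 cfg ng cng fg le_fg Bd eg hn
  => *; lra.
Qed.

End CantorLowerBound.

(** * Sums along the edges of a tree *)

Section TreeFrame.
Context {R : realType}.

(* Edges of the bipartite double cover of the tree in which n has parent n/4. *)
Definition tree_edges : set (nat * nat) :=
  [set ij | ij.1 = (ij.2 %/ 4)%N \/ ij.2 = (ij.1 %/ 4)%N].

(** Every vertex has exactly four children, without exception at the root, since 0 is a child of
    itself. *)
Lemma sum_div4 (a : nat -> R) m :
  \sum_(0 <= k < 4 * m) a (k %/ 4)%N = 4 * \sum_(0 <= k < m) a k.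
Proof.
elim: m => [|m ih]; first by rewrite muln0 !big_geq// mulr0.
rewrite (_ : 4 * m.+1 = (4 * m).+4)%N; last by lia.
rewrite !big_nat_recr//= ih mulrDr -!addrA; congr (_ + _).
have -> : (4 * m %/ 4 = m)%N by rewrite mulKn.
have -> : ((4 * m).+1 %/ 4 = m)%N by lia.
have -> : ((4 * m).+2 %/ 4 = m)%N by lia.
have -> : ((4 * m).+3 %/ 4 = m)%N by lia.
by ring.
Qed.

Lemma sum_div4_le (a : nat -> R) m : (forall k, 0 <= a k) ->
  \sum_(0 <= k < m) a (k %/ 4)%N <= 4 * \sum_(0 <= k < m) a k.
Proof.
move=> a0; rewrite -sum_div4 [leRHS](big_cat_nat (n := m))//=; last by lia.
by rewrite lerDl sumr_ge0.
Qed.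

Lemma esum_subset (T : choiceType) (A B : set T) (a : T -> \bar R) :
  A `<=` B -> (forall x, 0 <= a x)%E ->
  (\esum_(i in A) a i <= \esum_(i in B) a i)%E.
Proof.
move=> AB a0; rewrite (esumID A B)// setIidr//.
by rewrite leeDl// esum_ge0.
Qed.

Lemma esum_setU_le (T : choiceType) (A B : set T) (a : T -> \bar R) :
  (forall x, 0 <= a x)%E ->
  (\esum_(i in A `|` B) a i <= \esum_(i in A) a i + \esum_(i in B) a i)%E.
Proof.
move=> a0; rewrite (esumID A (A `|` B))//; apply: leeD; apply: esum_subset => //.
by move=> x [[]].
Qed.

Lemma nneseries_le (a : nat -> R) (c : R) : (forall k, 0 <= a k) ->
  (forall n, \sum_(0 <= k < n) a k <= c) -> (\sum_(k <oo) (a k)%:E <= c%:E)%E.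
Proof.
move=> a0 ac; apply: lime_le.
  by apply: is_cvg_nneseries => n _ _; rewrite lee_fin.
by apply: nearW => n; rewrite sumEFin lee_fin.
Qed.

Variables (p q : nat -> R[i]).

(** Each coefficient lies on four edges to children and one to its parent; with the factor 2 of
    [nsqD_le] this gives 8 + 2 = 10. The edge (0, 0) is in both families, hence subadditivity
    instead of additivity. *)
Lemma tree_frame_upper (a b : R) :
  (forall n, \sum_(0 <= k < n) nsq (p k) <= a) ->
  (forall n, \sum_(0 <= k < n) nsq (q k) <= b) ->
  (\esum_(ij in tree_edges) (nsq (p ij.1 + q ij.2))%:E <= (10 * (a + b))%:E)%E.
Proof.
move=> pa qb.
have g0 (ij : nat * nat) : (0 <= (nsq (p ij.1 + q ij.2))%:E)%E by rewrite lee_fin nsq_ge0.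
have n0 (u : nat -> R[i]) k : 0 <= nsq (u k) by exact: nsq_ge0.
have -> : tree_edges = [set ((k %/ 4)%N, k) | k in setT] `|`
    [set (k, (k %/ 4)%N) | k in setT].
  apply/seteqP; split => [[i j] /= []/= ->|[i j] /= [] [k _ [<- <-]]]; [left|right|left|right] => //.
  - by exists j.
  - by exists i.
apply: (le_trans (esum_setU_le _ _ g0)).
rewrite (_ : 10 * (a + b) = (8 * a + 2 * b) + (2 * a + 8 * b)); last by ring.
rewrite EFinD; apply: leeD.
- rewrite esum_image; last by move=> k k' _ _ [].
  rewrite -nneseries_esumT//; apply: nneseries_le => [k|n]; first exact: nsq_ge0.
  apply: (@le_trans _ _ (\sum_(0 <= k < n) (2 * nsq (p (k %/ 4)%N) + 2 * nsq (q k)))).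
    by apply: ler_sum => k _; exact: nsqD_le.
  rewrite big_split -!big_distrr /=.
  have := @sum_div4_le (fun k => nsq (p k)) n (n0 p); have := pa n; have := qb n => /=.
  by move: (\sum_(_ <= _ < _) _) (\sum_(_ <= _ < _) _) (\sum_(_ <= _ < _) _) => *; lra.
- rewrite esum_image; last by move=> k k' _ _ [].
  rewrite -nneseries_esumT//; apply: nneseries_le => [k|n]; first exact: nsq_ge0.
  apply: (@le_trans _ _ (\sum_(0 <= k < n) (2 * nsq (p k) + 2 * nsq (q (k %/ 4)%N)))).
    by apply: ler_sum => k _; exact: nsqD_le.
  rewrite big_split -!big_distrr /=.
  have := @sum_div4_le (fun k => nsq (q k)) n (n0 q); have := pa n; have := qb n => /=.
  by move: (\sum_(_ <= _ < _) _) (\sum_(_ <= _ < _) _) (\sum_(_ <= _ < _) _) => *; lra.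
Qed.

(* Each vertex has four children, so 4X <= 2S + 2Y and 4Y <= 2S + 2X, where X and
   Y are the squared norms of p and q and S is the sum over the edges. *)
Lemma tree_frame_lower (a b a' b' : R) :
  (forall n, \sum_(0 <= k < n) nsq (p k) <= a') ->
  (forall n, \sum_(0 <= k < n) nsq (q k) <= b') ->
  (forall e, 0 < e -> exists n, a - e <= \sum_(0 <= k < n) nsq (p k)) ->
  (forall e, 0 < e -> exists n, b - e <= \sum_(0 <= k < n) nsq (q k)) ->
  ((2^-1 * (a + b))%:E <= \esum_(ij in tree_edges) (nsq (p ij.1 + q ij.2))%:E)%E.
Proof.
move=> pa qb pe qe.
have n0 (u : nat -> R[i]) k : (0 <= (nsq (u k))%:E)%E by rewrite lee_fin nsq_ge0.
have g0 (ij : nat * nat) : (0 <= (nsq (p ij.1 + q ij.2))%:E)%E by rewrite lee_fin nsq_ge0.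
set S := \esum_(_ in _) _; have S0 : (0 <= S)%E by exact: esum_ge0.
have [->|Sfin] := eqVneq S +oo%E; first exact: leey.
have /fineK Ss : S \is a fin_num by rewrite ge0_fin_numE// lt_neqAle Sfin leey.
set s := fine S in Ss; rewrite -Ss lee_fin.
(* Total energies as least upper bounds of partial sums. Their finiteness, due to [a'] and [b'], is
   what allows (x + y)/2 to be absorbed at the end. *)
have ex_lim (u : nat -> R[i]) c : (forall n, \sum_(0 <= k < n) nsq (u k) <= c) ->
    exists x : R, (forall n, \sum_(0 <= k < n) nsq (u k) <= x) /\
      forall y, (forall n, \sum_(0 <= k < n) nsq (u k) <= y) -> x <= y.
  move=> uc; exists (fine (\sum_(k <oo) (nsq (u k))%:E)%E).
  have X0 : (0 <= \sum_(k <oo) (nsq (u k))%:E)%E by exact: nneseries_ge0.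
  have Xfin : (\sum_(k <oo) (nsq (u k))%:E)%E \is a fin_num.
    rewrite ge0_fin_numE//; apply: (@le_lt_trans _ _ c%:E); last exact: ltry.
    by apply: nneseries_le => // k; exact: nsq_ge0.
  split=> [n|y hy]; rewrite -lee_fin fineK//.
    by rewrite -sumEFin; exact: nneseries_lim_ge.
  by apply: nneseries_le => // k; exact: nsq_ge0.
have [x [xp px]] := ex_lim _ _ pa; have [y [yq qy]] := ex_lim _ _ qb.
have S1 n : \sum_(0 <= k < n) nsq (p (k %/ 4)%N + q k) <= s.
  rewrite -lee_fin Ss -sumEFin.
  apply: (@le_trans _ _ (\sum_(k <oo) (nsq (p (k %/ 4)%N + q k))%:E)%E).
    by apply: nneseries_lim_ge => k _ _; exact: (n0 (fun k => p (k %/ 4)%N + q k)).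
  rewrite nneseries_esumT; last by move=> k; exact: (n0 (fun k => p (k %/ 4)%N + q k)).
  rewrite -(@esum_image R _ _ setT (fun k => ((k %/ 4)%N, k))
    (fun ij => (nsq (p ij.1 + q ij.2))%:E)); last by move=> k k' _ _ [].
  by apply: esum_subset => // _ [k _ <-]; left.
have S2 n : \sum_(0 <= k < n) nsq (p k + q (k %/ 4)%N) <= s.
  rewrite -lee_fin Ss -sumEFin.
  apply: (@le_trans _ _ (\sum_(k <oo) (nsq (p k + q (k %/ 4)%N))%:E)%E).
    by apply: nneseries_lim_ge => k _ _; exact: (n0 (fun k => p k + q (k %/ 4)%N)).
  rewrite nneseries_esumT; last by move=> k; exact: (n0 (fun k => p k + q (k %/ 4)%N)).
  rewrite -(@esum_image R _ _ setT (fun k => (k, (k %/ 4)%N))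
    (fun ij => (nsq (p ij.1 + q ij.2))%:E)); last by move=> k k' _ _ [].
  by apply: esum_subset => // _ [k _ <-]; right.
have xs : x <= (s + y) / 2.
  apply: px => n; have := @sum_div4 (fun k => nsq (p k)) n.
  have : \sum_(0 <= k < 4 * n) nsq (p (k %/ 4)%N) <=
      2 * \sum_(0 <= k < 4 * n) nsq (p (k %/ 4)%N + q k) + 2 * \sum_(0 <= k < 4 * n) nsq (q k).
    rewrite !big_distrr -big_split /=; apply: ler_sum => k _.
    by rewrite {1}(_ : p _ = p (k %/ 4)%N + q k - q k) ?nsqB_le// addrK.
  have := S1 (4 * n)%N; have := yq (4 * n)%N.
  by move: (\sum_(_ <= _ < _) _) (\sum_(_ <= _ < _) _) (\sum_(_ <= _ < _) _) => /= *; lra.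
have ys : y <= (s + x) / 2.
  apply: qy => n; have := @sum_div4 (fun k => nsq (q k)) n.
  have : \sum_(0 <= k < 4 * n) nsq (q (k %/ 4)%N) <=
      2 * \sum_(0 <= k < 4 * n) nsq (p k + q (k %/ 4)%N) + 2 * \sum_(0 <= k < 4 * n) nsq (p k).
    rewrite !big_distrr -big_split /=; apply: ler_sum => k _.
    by rewrite {1}(_ : q _ = p k + q (k %/ 4)%N - p k) ?nsqB_le// addrC addKr.
  have := S2 (4 * n)%N; have := xp (4 * n)%N.
  by move: (\sum_(_ <= _ < _) _) (\sum_(_ <= _ < _) _) (\sum_(_ <= _ < _) _) => /= *; lra.
have ax : a <= x.
  by apply/ler_addgt0Pr => e /pe[n an]; have := xp n; lra.
have by_ : b <= y.
  by apply/ler_addgt0Pr => e /qe[n bn]; have := yq n; lra.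
lra.
Qed.

End TreeFrame.

(** * The frame for independent directions *)

Section RhoIntegration.
Context {R : realType}.
Variables (mu4 mu16 : probability R R) (theta : R).

Definition xaxis (x : R) : R * R := (x, 0).
Definition rotated_yaxis (y : R) : R * R := rotation theta (0, y).

Lemma measurable_xaxis : measurable_fun setT xaxis.
Proof. by apply: measurable_fun_pair. Qed.

Lemma measurable_rotated_yaxis : measurable_fun setT rotated_yaxis.
Proof.
apply: (measurableT_comp (measurable_rotation theta)).
by apply: measurable_fun_pair.
Qed.

(** A product with a Dirac mass is the image of the other factor under the embedding of a line: the
    section at x has mass 1 for the Dirac factor exactly when (x, 0) is in [E], and integration
    against a Dirac mass picks the section at 0. *)
Lemma rho_mixture E : measurable E -> rho mu4 mu16 theta E =
  (1%:E * mu4 (xaxis @^-1` E) + 1%:E * mu16 (rotated_yaxis @^-1` E))%E.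
Proof.
move=> mE; rewrite /rho !mul1e; congr (_ + _)%E.
- have mA : measurable (xaxis @^-1` E).
    by rewrite -[X in measurable X]setTI; exact: measurable_xaxis.
  rewrite /product_measure1 -[in RHS](setIT (xaxis @^-1` E)) -integral_indic//.
  apply: eq_integral => x _; rewrite /= diracE indicE; congr (_%:E).
  congr ((nat_of_bool _)%:R); apply/idP/idP => /set_mem h; apply/mem_set => //=.
    by move: h; rewrite /xsection /= => /set_mem.
  by rewrite /xsection /=; exact/mem_set.
- have mB : measurable (rotation theta @^-1` E).
    by rewrite -[X in measurable X]setTI; exact: measurable_rotation.
  rewrite /product_measure1 integral_dirac//; last exact: measurable_fun_xsection.
  rewrite diracT mul1e /=; congr (mu16 _).
  apply/seteqP; split => y; rewrite /xsection /=; first by move/set_mem.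
  by move=> ?; exact/mem_set.
Qed.

Lemma L2_cL2 f : L2 (rho mu4 mu16 theta) f -> cL2 (rho mu4 mu16 theta) f.
Proof.
move=> [m1 m2 foo]; split; first by [].
apply/integrableP; split; first exact/measurable_EFinP/measurable_nsq.
move: foo; rewrite /L2normsq; apply: le_lt_trans; rewrite le_eqVlt; apply/orP; left.
apply/eqP/eq_integral => x _; rewrite nsqE gee0_abs//= lee_fin; exact: nsq_ge0.
Qed.

Lemma cL2_L2 f : cL2 (rho mu4 mu16 theta) f -> L2 (rho mu4 mu16 theta) f.
Proof.
move=> hf; have [[m1 m2] _] := hf; split=> //.
rewrite /L2normsq; under eq_integral do rewrite nsqE.
by rewrite -(norm2E hf) ltry.
Qed.

Lemma cL2_rho f : cL2 (rho mu4 mu16 theta) f ->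
  cL2 mu4 (f \o xaxis) /\ cL2 mu16 (f \o rotated_yaxis).
Proof.
exact: (cL2_mixture measurable_xaxis measurable_rotated_yaxis ltr01 rho_mixture).
Qed.

Lemma L2normsq_rho f : cL2 (rho mu4 mu16 theta) f ->
  L2normsq (rho mu4 mu16 theta) f =
  (norm2 mu4 (f \o xaxis) + norm2 mu16 (f \o rotated_yaxis))%:E.
Proof.
move=> hf; rewrite /L2normsq; under eq_integral do rewrite nsqE.
rewrite -(norm2E hf); congr (_%:E).
by rewrite (norm2_mixture measurable_xaxis measurable_rotated_yaxis ltr01 rho_mixture)// !mul1r.
Qed.

(** On each of the two lines a plane wave is a one-dimensional exponential, whose frequency is the
    component of [l] along that line. *)
Lemma cintegral_rho f (l : R * R) : cL2 (rho mu4 mu16 theta) f ->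
  cintegral (rho mu4 mu16 theta) (fun x => f x * fourier_char l x) =
  ft mu4 (f \o xaxis) l.1 +
  ft mu16 (f \o rotated_yaxis) (- sin theta * l.1 + cos theta * l.2).
Proof.
move=> hf.
have mdot : measurable_fun setT (fun x : R * R => dotp l x).
  by apply: measurable_funD; apply: measurable_funM.
have mchar : cmeasurable (fourier_char l).
  split; rewrite /fourier_char /=.
  - apply: (measurableT_comp (f := @cos R)); last exact: measurable_funM.
    by apply: continuous_measurable_fun; exact: continuous_cos.
  - apply: (measurableT_comp (f := @sin R)); last exact: measurable_funM.
    by apply: continuous_measurable_fun; exact: continuous_sin.
have hfl : cL2 (rho mu4 mu16 theta) (fun x => f x * fourier_char l x).
  by apply: cL2M1 => // x; rewrite -[fourier_char l x]/(ech (dotp l x)) nsq_ech.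
rewrite -[LHS]/(cint (rho mu4 mu16 theta) (fun x => f x * fourier_char l x)).
rewrite (cint_mixture measurable_xaxis measurable_rotated_yaxis ltr01 rho_mixture);
  [|exact: cL2_Re hfl|exact: cL2_Im hfl].
rewrite mul1r; congr (_ + _); apply: eq_cint => x /=; congr (_ * ech _).
- by rewrite /dotp /xaxis /= mulr0 addr0.
- by rewrite /dotp /rotated_yaxis /rotation /= !mulr0 sub0r add0r; ring.
Qed.

End RhoIntegration.

Section Frames.
Context {R : realType}.
Variables (mu4 mu16 : probability R R).
Hypotheses (hmu4 : cantor_measure 4 mu4) (hmu16 : cantor_measure 16 mu16).

(* In the coordinates (<l, u>, <l, v>), u and v being the directions of the two
   supporting lines, these frequencies do not depend on theta. *)
Definition tree_freq (theta : R) (ij : nat * nat) : R * R :=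
  (freq 2 ij.1, (freq 8 ij.2 + sin theta * freq 2 ij.1) / cos theta).

Lemma cos_neq0 (theta : R) : - pi < theta -> theta <= pi ->
  theta <> pi / 2 -> theta <> - (pi / 2) -> cos theta != 0.
Proof.
move=> t1 t2 t3 t4; have p0 := pi_gt0 R.
have [tp|tp] := ltP theta (- (pi / 2)).
  have : 0 < cos (theta + pi) by apply: cos_gt0_pihalf; apply/andP; split; lra.
  by rewrite cosDpi oppr_gt0 => /lt_eqF ->.
have [tp'|tp'] := ltP (pi / 2) theta.
  have : 0 < cos (theta - pi) by apply: cos_gt0_pihalf; apply/andP; split; lra.
  by rewrite -{2}(subrK pi theta) cosDpi oppr_eq0 => /gt_eqF ->.
suff /gt_eqF -> : 0 < cos theta by [].
apply: cos_gt0_pihalf; rewrite !lt_neqAle tp tp' !andbT.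
by apply/andP; split; apply/eqP => // e; apply: t4.
Qed.

(** A frame is indexed by a set of frequencies, so its sum is the sum over edges only if distinct
    edges give distinct frequencies. *)
Lemma tree_freq_inj theta : cos theta != 0 -> injective (tree_freq theta).
Proof.
move=> c0 [i j] [i' j'] [/(freq_inj (leqnn 2)) <-] /= /(mulIf (invr_neq0 c0)).
by move=> /addIr/freq_inj ->.
Qed.

Lemma rho_fourier_frame theta : cos theta != 0 ->
  fourier_frame (rho mu4 mu16 theta) [set tree_freq theta ij | ij in tree_edges]
    (cosc ^+ 2 / 32) 10.
Proof.
move=> c0 f /L2_cL2 hf; have [h4 h16] := cL2_rho hf.
rewrite L2normsq_rho// esum_image; last by move=> ? ? _ _; exact: tree_freq_inj.
pose p k := ft mu4 (f \o xaxis) (freq 2 k).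
pose q k := ft mu16 (f \o rotated_yaxis theta) (freq 8 k).
rewrite (eq_esum (b := fun ij => (nsq (p ij.1 + q ij.2))%:E)); last first.
  move=> [i j] _; rewrite nsqE cintegral_rho//= /p /q; congr ((nsq (_ + ft _ _ _))%:E).
  (* The sine term built into the second coordinate cancels the contribution of the first coordinate
     along the rotated line. *)
  by rewrite [cos theta * _]mulrC divfK// addrC mulNr addrK.
have pa n : \sum_(0 <= k < n) nsq (p k) <= norm2 mu4 (f \o xaxis).
  exact: (bessel (leqnn 2) hmu4).
have qb n : \sum_(0 <= k < n) nsq (q k) <= norm2 mu16 (f \o rotated_yaxis theta).
  by apply: bessel.
rewrite -!EFinM; apply/andP; split; last exact: tree_frame_upper.
(* 1/32 is the 1/16 of [frame_lower_bound] times the 1/2 of [tree_frame_lower]. *)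
rewrite (_ : cosc ^+ 2 / 32 * _ = 2^-1 * (cosc ^+ 2 / 16 * norm2 mu4 (f \o xaxis) +
  cosc ^+ 2 / 16 * norm2 mu16 (f \o rotated_yaxis theta))).
  apply: tree_frame_lower pa qb _ _ => e e0.
    exact: (frame_lower_bound (leqnn 2) hmu4).
  by apply: frame_lower_bound.
move: (norm2 _ _) (norm2 _ _) (cosc ^+ 2) => x y z; by field.
Qed.

Lemma countable_tree_freq theta : countable [set tree_freq theta ij | ij in tree_edges].
Proof. by apply: (sub_countable (card_image_le _ _)); exact: countableP. Qed.

End Frames.

(** * Parallel directions *)

Section Zoom.
Context {R : realType}.
Variables (N : nat) (mu : probability R R).
Hypotheses (N_ge4 : (4 <= N)%N) (hmu : cantor_measure N mu).

Local Notation Nr := (N%:R : R).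
Local Notation s := (7 / 20 : R).

Let N_gt0 : 0 < Nr. Proof. by rewrite ltr0n; lia. Qed.
Let Nr_ge4 : 4 <= Nr. Proof. by rewrite (ler_nat R 4 N). Qed.
Let supp : 1 < (Nr - 1) * s.
Proof. by have := Nr_ge4; move: Nr => z; lra. Qed.

Lemma eq_cint_supp r f g : 1 < (Nr - 1) * r -> cL2 mu f -> cL2 mu g ->
  (forall x, `|x| <= r -> f x = g x) -> cint mu f = cint mu g.
Proof.
move=> r1 hf hg fg; apply: complex_ReIm => /=; apply/eqP; rewrite eq_le; apply/andP; split;
  apply: (le_Rintegral_supp N_ge4 hmu r1); try exact: cL2_Re; try exact: cL2_Im;
  by move=> x /fg ->.
Qed.

Lemma cint_cst (c : R[i]) : cint mu (fun=> c) = c.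
Proof.
have mu1 : fine (mu setT) = 1 by rewrite (@probability_setT _ _ _ mu).
by apply: complex_ReIm; rewrite /= Rintegral_cst// mu1 mulr1.
Qed.

Definition window (a r : R) : set R := [set x | `|x - a| <= r].

Lemma measurable_window a r : measurable (window a r).
Proof.
rewrite (_ : window a r = `[a - r, a + r]%classic); first exact: measurable_itv.
by apply/seteqP; split => x; rewrite /window /= in_itv/= ler_distl.
Qed.

Lemma cindic_window a r x : cindic (window a r) x = if `|x - a| <= r then 1 else 0.
Proof.
rewrite /cindic indicE; case: ifPn => h.
  by rewrite mem_set.
by rewrite memNset//; exact/negP.
Qed.

Lemma nsq_cindic_le1 (E : set R) x : nsq (cindic E x) <= 1.
Proof. by rewrite /cindic nsq_real indicE; case: (_ \in _) => /=; lra. Qed.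

Lemma cL2_window g a r : cL2 mu g -> cL2 mu (fun x => g x * cindic (window a r) x).
Proof.
move=> hg; apply: cL2M1 => //; last by move=> x; exact: nsq_cindic_le1.
by apply: measurable_cindic; exact: measurable_window.
Qed.

(* Up to a null set, this window is the cylinder of level n containing 0. *)
Lemma cint_window0 n g : cL2 mu g ->
  cL2 mu (fun x => g (x / Nr ^+ n)) /\
  cint mu (fun x => g x * cindic (window 0 (s / Nr ^+ n)) x) =
  ((2^-1) ^+ n)%:C%C * cint mu (fun x => g (x / Nr ^+ n)).
Proof.
elim: n g => [|n ih] g hg.
  have e : (fun x => g (x / Nr ^+ 0)) = g by apply/funext => x; rewrite expr0 divr1.
  rewrite e; split=> //; rewrite !expr0 mul1r divr1.
  apply: (eq_cint_supp supp) => //; first exact: cL2_window.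
  by move=> x xs; rewrite cindic_window subr0 xs mulr1.
have [h0 h1] := cL2_digit N_ge4 hmu hg; have [hs e] := ih _ h0.
have eS : (fun x => g (x / Nr ^+ n.+1)) = (fun x => (g \o digit N false) (x / Nr ^+ n)).
  by apply/funext => x /=; rewrite /digit addr0 exprSr invfM mulrA.
rewrite eS; split=> //; rewrite (cint_digit N_ge4 hmu); last exact: cL2_window.
have [w0 w1] := cL2_digit N_ge4 hmu (@cL2_window g 0 (s / Nr ^+ n.+1) hg).
have Nn : 0 < Nr ^+ n by rewrite exprn_gt0.
have nN : 1 <= Nr ^+ n by rewrite exprn_ege1// ler1n; lia.
(* The half with digit 1 misses the window: |x + 1| <= 7/20 and |x| <= 7/20 exclude each other. The
   radius 7/20 is above 1/3, to contain the support when N = 4, and below 1/2. *)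
rewrite [X in _ + X](_ : _ = 0) ?addr0; last first.
  rewrite -(cint_cst 0); apply: (eq_cint_supp supp w1); first exact: cL2_cst.
  move=> x /= xs; rewrite cindic_window subr0 /digit ifF ?mulr0//.
  apply/negP; rewrite normf_div (ger0_norm (ltW N_gt0)) ler_pdivrMr//.
  rewrite exprSr invfM mulrA mulfVK ?gt_eqF// => h.
  have : s / Nr ^+ n <= s by rewrite ler_pdivrMr// ler_peMr.
  have := ler_norm (x + 1); have := ler_norm (- x); rewrite normrN; lra.
rewrite (_ : cint _ (_ \o _) = cint mu (fun x => (g \o digit N false) x *
    cindic (window 0 (s / Nr ^+ n)) x)).
  by rewrite e exprS mulrA rmorphM.
apply: eq_cint => x /=; congr (_ * _); rewrite !cindic_window !subr0 /digit addr0.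
rewrite normf_div (ger0_norm (ltW N_gt0)) ler_pdivrMr//.
by rewrite exprSr invfM mulrA mulfVK ?gt_eqF.
Qed.

(** Up to a null set, this window is the cylinder with first digit 1 followed by n zeros; past the
    first digit it is the window at 0 of level n. *)
Lemma cint_window_digit n g : cL2 mu g ->
  cint mu (fun x => g x * cindic (window (Nr^-1) (s / Nr ^+ n.+1)) x) =
  ((2^-1) ^+ n.+1)%:C%C * cint mu (fun x => g ((x / Nr ^+ n + 1) / Nr)).
Proof.
move=> hg; rewrite (cint_digit N_ge4 hmu); last exact: cL2_window.
have [h0 h1] := cL2_digit N_ge4 hmu hg.
have [w0 w1] := cL2_digit N_ge4 hmu (@cL2_window g (Nr^-1) (s / Nr ^+ n.+1) hg).
have Nn : 0 < Nr ^+ n by rewrite exprn_gt0.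
have nN : 1 <= Nr ^+ n by rewrite exprn_ege1// ler1n; lia.
have win b x : (`|digit N b x - Nr^-1| <= s / Nr ^+ n.+1) =
    (`|x + b%:R - 1| <= s / Nr ^+ n).
  rewrite /digit -[X in _ - X]mul1r -mulrBl normf_div (ger0_norm (ltW N_gt0)).
  by rewrite ler_pdivrMr// exprSr invfM mulrA mulfVK ?gt_eqF.
rewrite [X in X + _](_ : _ = 0) ?add0r; last first.
  rewrite -(cint_cst 0); apply: (eq_cint_supp supp w0); first exact: cL2_cst.
  move=> x /= xs; rewrite cindic_window win addr0 ifF ?mulr0//.
  apply/negP => h.
  have : s / Nr ^+ n <= s by rewrite ler_pdivrMr// ler_peMr.
  have := ler_norm (- (x - 1)); have := ler_norm x; rewrite normrN; lra.
rewrite (_ : cint _ (_ \o _) = cint mu (fun x => (g \o digit N true) x *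
    cindic (window 0 (s / Nr ^+ n)) x)).
  have [_ ->] := cint_window0 n h1.
  by rewrite exprS mulrA rmorphM.
by apply: eq_cint => x /=; congr (_ * _); rewrite !cindic_window win addrK subr0.
Qed.

Lemma norm2_cindic E : measurable E -> norm2 mu (cindic E) = complex.Re (cint mu (cindic E)).
Proof.
move=> mE /=; apply: eq_Rintegral => x _; rewrite /cindic nsq_real /= indicE.
by case: (_ \in _); rewrite /= ?expr1n ?expr0n.
Qed.

Lemma cL2_ech1 t : cL2 mu (fun x => ech (t * x)).
Proof.
apply: (@le_cL2 _ _ _ _ _ (fun=> 1)); first exact: measurable_ech.
- by move=> x; rewrite nsq_ech.
- exact: Rintegrable_cst.
Qed.

Lemma ft_cst1 t : ft mu (fun=> 1) t = cint mu (fun x => ech (t * x)).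
Proof. by apply: eq_cint => x; rewrite mul1r. Qed.

Lemma ft_window0 n t : ft mu (cindic (window 0 (s / Nr ^+ n))) t =
  ((2^-1) ^+ n)%:C%C * ft mu (fun=> 1) (t / Nr ^+ n).
Proof.
have [_ e] := cint_window0 n (cL2_ech1 t).
rewrite ft_cst1 (@eq_cint _ _ _ _ _ (fun x : R => ech (t * (x / Nr ^+ n)))).
  by rewrite -e; apply: eq_cint => x; rewrite mulrC.
by move=> x; rewrite mulrA mulrAC.
Qed.

(** Moving the window to 1/N only adds the unimodular factor e^(2 pi i t/N). *)
Lemma nsq_ft_window_digit n t :
  nsq (ft mu (cindic (window (Nr^-1) (s / Nr ^+ n.+1))) t) =
  ((2^-1) ^+ n.+1) ^+ 2 * nsq (ft mu (fun=> 1) (t / Nr ^+ n.+1)).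
Proof.
rewrite /ft (@eq_cint _ _ _ _ _ (fun x : R => ech (t * x) *
  cindic (window (Nr^-1) (s / Nr ^+ n.+1)) x)); last by move=> x; rewrite mulrC.
rewrite (cint_window_digit _ (cL2_ech1 t)) nsqM nsq_real; congr (_ * _).
rewrite (@eq_cint _ _ _ _ _ (fun x : R => ech (t / Nr) * (1 * ech (t / Nr ^+ n.+1 * x)))).
  by rewrite cintZ ?nsqM ?nsq_ech ?mul1r//; apply: cL2_ech; exact: cL2_cst.
move=> x; rewrite mul1r -echD; congr ech; rewrite exprS.
by field; rewrite !gt_eqF// exprn_gt0.
Qed.

Lemma norm2_window0 n : norm2 mu (cindic (window 0 (s / Nr ^+ n))) = (2^-1) ^+ n.
Proof.
rewrite norm2_cindic; last exact: measurable_window.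
have [_] := cint_window0 n (cL2_cst mu 1); rewrite cint_cst mulr1.
rewrite (@eq_cint _ _ _ _ _ (cindic (window 0 (s / Nr ^+ n)))) => [->//|x].
by rewrite mul1r.
Qed.

Lemma norm2_window_digit n :
  norm2 mu (cindic (window (Nr^-1) (s / Nr ^+ n.+1))) = (2^-1) ^+ n.+1.
Proof.
rewrite norm2_cindic; last exact: measurable_window.
have := cint_window_digit n (cL2_cst mu 1); rewrite cint_cst mulr1.
rewrite (@eq_cint _ _ _ _ _ (cindic (window (Nr^-1) (s / Nr ^+ n.+1)))) => [->//|x].
by rewrite mul1r.
Qed.

(** The two values are complex conjugates. This symmetry handles the angle that reverses the second
    line when it lands on the x-axis. *)
Lemma ft_cst1N t : nsq (ft mu (fun=> 1) (- t)) = nsq (ft mu (fun=> 1) t).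
Proof.
have h : cL2 mu (fun x => 1 * ech (t * x)) by apply: cL2_ech; exact: cL2_cst.
have -> : ft mu (fun=> 1) (- t) = ((ft mu (fun=> 1) t)^*)%C.
  apply: complex_ReIm => /=.
    by apply: eq_Rintegral => x _; rewrite mulNr !mulrN cosN; congr (_ - _); ring.
  rewrite -mulN1r -RintegralZl//; last exact: (cL2_Im h).
  by apply: eq_Rintegral => x _; rewrite mulNr !mulrN sinN cosN; ring.
by case: (ft _ _ _) => a b; rewrite /nsq /= sqrrN.
Qed.

(** The trigonometric mask of the refinement equation; its modulus is |cos (pi t)|. *)
Definition mask (t : R) : R[i] := (2^-1)%:C%C * (1 + ech t).

Lemma nsq_mask_le1 t : nsq (mask t) <= 1.
Proof.
rewrite /mask nsqM nsq_real; have := nsqD_le 1 (ech t).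
by rewrite nsq_ech nsq1 => h; lra.
Qed.

Lemma ft_mask t : ft mu (fun=> 1) t = mask (t / Nr) * ft mu (fun=> 1) (t / Nr).
Proof.
have h u : cL2 mu (fun x => 1 * ech (u * x)) by apply: cL2_ech; exact: cL2_cst.
have [h0 h1] := cL2_digit N_ge4 hmu (h t).
rewrite /ft (cint_digit N_ge4 hmu)// -cintD// /mask -[RHS]mulrA; congr (_ * _).
rewrite -cintZ//; apply: eq_cint => x /=.
rewrite !mul1r mulrDl mul1r -echD; congr (ech _ + ech _).
- by rewrite /digit addr0 mulrA mulrAC.
- by rewrite /digit mulrA mulrAC mulrDr mulr1 addrC.
Qed.

End Zoom.

(** * Comparison of the two transforms and failure of the frame inequalities *)

Section NotFrame.
Context {R : realType}.
Variables (mu4 mu16 : probability R R).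
Hypotheses (hmu4 : cantor_measure 4 mu4) (hmu16 : cantor_measure 16 mu16).

Local Notation hat4 := (ft mu4 (fun=> 1)).
Local Notation hat16 := (ft mu16 (fun=> 1)).
Local Notation s := (7 / 20 : R).

(* mu4 is the convolution of mu16 with its dilation by 4, so |hat4| <= |hat16|;
   the constant [cosc] avoids a limit. *)
Lemma hat4_le_hat16 t : cosc ^+ 2 * nsq (hat4 t) <= nsq (hat16 t).
Proof.
have main k u : `|u| <= 2 / 3 * 16 ^+ k -> cosc ^+ 2 * nsq (hat4 u) <= nsq (hat16 u).
  elim: k u => [|k ih] u.
    rewrite expr0 mulr1 => u1.
    apply: le_trans (@ft1_ge _ 8 mu16 isT hmu16 _ u1).
    rewrite ler_piMr ?sqr_ge0//; apply: (le_trans (ft_le _ (cL2_cst _ _))).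
    rewrite /norm2 nsq1 Rintegral_cst// (_ : fine (mu4 setT) = 1) ?mulr1//.
    by rewrite (@probability_setT _ _ _ mu4).
  rewrite exprSr mulrA => uk.
  have {}/ih ih : `|u / 16| <= 2 / 3 * 16 ^+ k.
    by rewrite normf_div (ger0_norm (x := 16))// ler_pdivrMr.
  (* One step in base 16 against two in base 4: both reach u/16 with the common factor mask (u/16),
     and [mu4] has the extra factor mask (u/4), of modulus at most 1. *)
  rewrite (@ft_mask _ 16 mu16 isT hmu16) (@ft_mask _ 4 mu4 isT hmu4).
  rewrite (@ft_mask _ 4 mu4 isT hmu4 (u / 4)) !(nsqM (mask _)).
  have u16 : u / 4 / 4 = u / 16 by lra.
  rewrite u16.
  have := nsq_mask_le1 (u / 4); have := nsq_ge0 (mask (u / 4)).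
  have := nsq_ge0 (mask (u / 16)); have := nsq_ge0 (hat4 (u / 16)).
  have := sqr_ge0 (@cosc R).
  move: (nsq (mask (u / 4))) (nsq (mask (u / 16))) ih => a b.
  move: (nsq (hat4 _)) (nsq (hat16 _)) (cosc ^+ 2) => x y c cxy c0 x0 b0 a0 a1.
  have cx0 : 0 <= c * x by rewrite mulr_ge0.
  have : b * (c * x) <= b * y by rewrite ler_wpM2l.
  have : a * (b * (c * x)) <= b * (c * x) by rewrite ler_piMl// mulr_ge0.
  by rewrite (_ : c * (a * (b * x)) = a * (b * (c * x))); [lra|ring].
have [k _ hk] : \forall k \near \oo, `|t| / (2 / 3) <= k%:R by exact: nbhs_infty_ger.
apply: (main k); have {}hk := hk k (leqnn k).
rewrite ler_pdivrMr// in hk; rewrite mulrC; apply: (le_trans hk).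
by rewrite ler_pM2r// -natrX ler_nat ltnW// ltn_expl.
Qed.

Lemma esum_le_scaled (T : choiceType) (D : set T) (a b : T -> R) (k C : R) :
  0 <= k -> (forall i, a i <= k * b i) ->
  (\esum_(i in D) (b i)%:E <= C%:E)%E -> (\esum_(i in D) (a i)%:E <= (k * C)%:E)%E.
Proof.
move=> k0 ab bC; apply: ge_ereal_sup => _ [X [finX XD] <-].
rewrite fsbig_finite//= sumEFin lee_fin.
apply: (@le_trans _ _ (k * \sum_(i <- fset_set X) b i)).
  by rewrite big_distrr; apply: ler_sum => i _; exact: ab.
rewrite ler_wpM2l// -lee_fin -sumEFin; apply: le_trans bC; apply: esum_ge.
by exists X => //; rewrite fsbig_finite.
Qed.

Lemma cL2_strip theta a r :
  cL2 (rho mu4 mu16 theta) (fun x : R * R => cindic (window a r) x.1).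
Proof.
have [m1 m2] := @measurable_cindic R _ (measurable_window a r).
apply: (@le_cL2 _ _ _ _ _ (fun=> 1)).
- by split; [exact: (measurableT_comp m1)|exact: (measurableT_comp m2)].
- by move=> x; exact: nsq_cindic_le1.
- exact: Rintegrable_cst.
Qed.

Lemma rho_not_frame_spectral theta : cos theta = 0 ->
  ~ frame_spectral (rho mu4 mu16 theta).
Proof.
move=> c0 [L [A [B [_ A0 AB frameL]]]].
have sin1 : sin theta = 1 \/ sin theta = -1.
  have := cos2Dsin2 theta; rewrite c0 expr0n add0r => /eqP.
  by rewrite sqrf_eq1 => /orP[] /eqP; [left|right].
have rot y : rotated_yaxis theta y = (- sin theta * y, 0).
  by rewrite /rotated_yaxis /rotation /= c0 !mul0r mulr0 sub0r addr0 mulNr.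
have normrot y : `|- sin theta * y| = `|y|.
  by case: sin1 => ->; rewrite ?mulN1r ?opprK ?mul1r ?normrN.
have B0 : 0 < B by exact: lt_le_trans AB.
have co0 := @cosc_gt0 R.
(* The first bound lets [F12] absorb the [mu4] part of F f2; the second contradicts the final
   inequality A cosc^2 <= 8 B d. *)
pose e := Num.min (cosc / 2) (A * cosc ^+ 2 / (8 * B)).
have e0 : 0 < e by rewrite lt_min !divr_gt0// ?mulr_gt0// exprn_gt0.
(* As 4^(2m) = 16^m, the level for [mu4] is 2m, written k + 1 to fit the window at 1/4. With d =
   2^-m, the windows have mass d^2 for [mu4] and, at 0, d for [mu16]. *)
have [m [k [mk en]]] : exists m k, m.*2 = k.+1 /\ (2^-1) ^+ m < e :> R.
  have [n _ hn] : \forall n \near \oo, e^-1 <= n%:R by exact: nbhs_infty_ger.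
  exists n.+1, n.*2.+1; split=> //; have {}hn := hn n (leqnn n).
  rewrite exprVn -[ltRHS]invrK ltf_pV2 ?posrE ?invr_gt0 ?exprn_gt0//.
  by apply: (le_lt_trans hn); rewrite -natrX ltr_nat (leq_ltn_trans (leqnSn n))// ltn_expl.
have m_gt0 : (0 < m)%N by lia.
have [d dm] : exists d : R, d = (2^-1) ^+ m by eexists.
rewrite -dm in en; have d0 : 0 < d by rewrite dm exprn_gt0.
have Q4 : 4 ^+ m.*2 = 16 ^+ m :> R by rewrite -mul2n exprM; congr (_ ^+ _); lra.
have d2 : (2^-1) ^+ m.*2 = d ^+ 2 :> R by rewrite dm -muln2 exprM.
have Q16 : 16 <= 16 ^+ m :> R by rewrite -(prednK m_gt0) exprS ler_peMr// exprn_ege1//; lra.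
have Q0 : 0 < 16 ^+ m :> R by rewrite exprn_gt0.
pose f1 (x : R * R) := cindic (window 4^-1 (s / 16 ^+ m)) x.1.
pose f2 (x : R * R) := cindic (window 0 (s / 16 ^+ m)) x.1.
have h1 : cL2 (rho mu4 mu16 theta) f1 by exact: cL2_strip.
have h2 : cL2 (rho mu4 mu16 theta) f2 by exact: cL2_strip.
pose F f l := cintegral (rho mu4 mu16 theta) (fun x => f x * fourier_char l x).
have F1E l : nsq (F f1 l) = d ^+ 4 * nsq (hat4 (l.1 / 16 ^+ m)).
  rewrite /F cintegral_rho// [X in _ + X](_ : _ = 0) ?addr0.
    have := @nsq_ft_window_digit _ 4 mu4 isT hmu4 k l.1.
    by rewrite -mk Q4 d2 -exprM.
  have [_ h1r] := cL2_rho h1.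
  (* [mu16] is carried by |y| <= 1/5, at distance 1/20 from 1/4, while the window has radius at most
     7/320. *)
  rewrite -(@cint_cst _ mu16 0); apply: (@eq_cint_supp _ 16 mu16 isT hmu16 (1 / 5)).
  - by lra.
  - exact: cL2_ech.
  - exact: cL2_cst.
  move=> y y5; rewrite /= /f1 rot /= cindic_window ifF ?mul0r//.
  apply/negP => h; have s16 : s / 16 ^+ m <= 7 / 20 / 16.
    by rewrite ler_wpM2l// lef_pV2 ?posrE.
  have := normrot y; have := ler_norm (- sin theta * y).
  have := ler_norm (- (- sin theta * y - 4^-1)); rewrite normrN => *; lra.
have F2E l : exists w, nsq w = nsq (hat16 (l.1 / 16 ^+ m)) /\
    F f2 l = (d ^+ 2)%:C%C * hat4 (l.1 / 16 ^+ m) + d%:C%C * w.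
  exists (hat16 (- sin theta * l.1 / 16 ^+ m)); split.
    by case: sin1 => ->; rewrite ?opprK ?mulN1r ?mul1r// mulNr ft_cst1N.
  rewrite /F cintegral_rho// c0 mul0r addr0; congr (_ + _).
    by have := @ft_window0 _ 4 mu4 isT hmu4 m.*2 l.1; rewrite Q4 d2.
  rewrite (_ : f2 \o rotated_yaxis theta = cindic (window 0 (s / 16 ^+ m))).
    by have := @ft_window0 _ 16 mu16 isT hmu16 m (- sin theta * l.1); rewrite -dm.
  by apply/funext => y; rewrite /= /f2 rot /= !cindic_window !subr0 normrot.
have c20 : 0 < cosc ^+ 2 :> R by rewrite exprn_gt0.
have dc : 4 * d ^+ 2 <= cosc ^+ 2.
  have : d < cosc / 2 by rewrite (lt_le_trans en)// ge_min lexx.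
  by nra.
(* With [w] from the [mu16] part of F f2, 4 d^2 <= cosc^2 and cosc^2 |hat4|^2 <= |w|^2 give 2 d^4
   |hat4|^2 <= d^2 |w|^2 / 2, so the [mu4] part is absorbed and d^2 |w|^2 <= 4 |F f2|^2. *)
have F12 l : nsq (F f1 l) <= 4 * d ^+ 2 / cosc ^+ 2 * nsq (F f2 l).
  have [w [wE zE]] := F2E l; rewrite F1E.
  have := hat4_le_hat16 (l.1 / 16 ^+ m); rewrite -wE.
  have : nsq (d%:C%C * w) <= 2 * nsq (F f2 l) + 2 * nsq ((d ^+ 2)%:C%C * hat4 (l.1 / 16 ^+ m)).
    rewrite (_ : d%:C%C * w = F f2 l - (d ^+ 2)%:C%C * hat4 (l.1 / 16 ^+ m)) ?nsqB_le//.
    by rewrite zE addrC addKr.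
  rewrite !nsqM !nsq_real -exprM => bZ ca; rewrite [leRHS]mulrAC ler_pdivlMr//; move: bZ ca.
  have := nsq_ge0 (hat4 (l.1 / 16 ^+ m)).
  move: (nsq w) (nsq (hat4 _)) (nsq (F _ _)) (cosc ^+ 2) c20 dc => b a Z c c_gt0 dc a0 bZ ca.
  have d20 : 0 < d ^+ 2 by rewrite exprn_gt0.
  have dE : d ^+ (2 * 2) = d ^+ 2 * d ^+ 2 by rewrite -exprD.
  rewrite dE in bZ; rewrite (_ : d ^+ 4 = d ^+ 2 * d ^+ 2); last by rewrite -exprD.
  move: (d ^+ 2) d20 dc bZ {dE} => D D0 Dc bZ.
  have Da : 4 * (D * (D * a)) <= c * (D * a).
    by rewrite mulrA ler_wpM2r// mulr_ge0// ltW.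
  have Dca : D * (c * a) <= D * b by rewrite ler_wpM2l// ltW.
  have Db : D * b <= 4 * Z by rewrite (_ : c * (D * a) = D * (c * a)) in Da; [lra|ring].
  have : D * (D * b) <= D * (4 * Z) by rewrite ler_wpM2l// ltW.
  have : D * (D * (c * a)) <= D * (D * b) by rewrite ler_wpM2l// ltW.
  by rewrite (_ : D * D * a * c = D * (D * (c * a))); [lra|ring].
have /andP[low _] := frameL f1 (cL2_L2 h1).
have /andP[_ upp] := frameL f2 (cL2_L2 h2).
have N1 : d ^+ 2 <= norm2 mu4 (f1 \o xaxis) + norm2 mu16 (f1 \o rotated_yaxis theta).
  rewrite (_ : norm2 mu4 _ = d ^+ 2) ?lerDl ?norm2_ge0//.
  by have := @norm2_window_digit _ 4 mu4 isT hmu4 k; rewrite -mk d2 Q4.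
have N2 : norm2 mu4 (f2 \o xaxis) + norm2 mu16 (f2 \o rotated_yaxis theta) = d ^+ 2 + d.
  rewrite (_ : f2 \o rotated_yaxis theta = cindic (window 0 (s / 16 ^+ m))).
    have := @norm2_window0 _ 16 mu16 isT hmu16 m; rewrite -dm => ->; congr (_ + _).
    by have := @norm2_window0 _ 4 mu4 isT hmu4 m.*2; rewrite d2 Q4.
  by apply/funext => y; rewrite /= /f2 rot /= !cindic_window !subr0 normrot.
rewrite L2normsq_rho// N2 in upp; rewrite L2normsq_rho// in low.
have upp' : (\esum_(l in L) (nsq (F f2 l))%:E <= (B * (d ^+ 2 + d))%:E)%E.
  by rewrite EFinM; apply: le_trans upp; apply: le_esum => l _; rewrite nsqE.
have k0 : 0 <= 4 * d ^+ 2 / cosc ^+ 2 by rewrite divr_ge0// ?mulr_ge0// ltW// exprn_gt0.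
(* The lower bound at f1 is chained through [F12] with the upper bound at f2: a quantity of order
   d^2 is at most one of order d^3. *)
have low' : (A * d ^+ 2 <= 4 * d ^+ 2 / cosc ^+ 2 * (B * (d ^+ 2 + d))).
  rewrite -lee_fin; apply: le_trans (esum_le_scaled k0 F12 upp').
  rewrite (eq_esum (b := fun l => (nsq (F f1 l))%:E)) in low; last first.
    by move=> l _; rewrite nsqE.
  by apply: le_trans low; rewrite -EFinM lee_fin ler_pM2l.
have : A * cosc ^+ 2 <= 4 * (B * (d ^+ 2 + d)).
  have D0 : 0 < d ^+ 2 by rewrite exprn_gt0.
  move: (cosc ^+ 2) c20 (d ^+ 2) D0 low' => c c_gt0 D D0.
  move: (B * _) => X.
  rewrite (_ : 4 * D / c * X = D * (4 * X) / c); last by ring.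
  by rewrite ler_pdivlMr// (mulrC A) -mulrA ler_pM2l.
have : d < A * cosc ^+ 2 / (8 * B) by rewrite (lt_le_trans en)// ge_min lexx orbT.
rewrite ltr_pdivlMr ?mulr_gt0// => h1' h2'.
have d1 : d <= 1 by rewrite dm exprn_ile1//; lra.
have Bd : B * d ^+ 2 <= B * d by rewrite ler_pM2l// expr2 ler_piMl// ltW.
lra.
Qed.

End NotFrame.

Theorem theorem1p6 (R : realType) (mu4 mu16 : probability R R)
    (hmu4 : cantor_measure 4 mu4) (hmu16 : cantor_measure 16 mu16) :
  [/\ forall theta : R, - pi < theta -> theta <= pi ->
        theta <> pi / 2 -> theta <> - (pi / 2) ->
        frame_spectral (rho mu4 mu16 theta),
      forall theta : R, theta = pi / 2 \/ theta = - (pi / 2) ->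
        ~ frame_spectral (rho mu4 mu16 theta) &
      exists A B : R, [/\ 0 < A, A <= B &
        forall theta : R, - pi < theta -> theta <= pi ->
          theta <> pi / 2 -> theta <> - (pi / 2) ->
          exists Lambda : set (R * R),
            countable Lambda /\
            fourier_frame (rho mu4 mu16 theta) Lambda A B]].
Proof.
have c20 : 0 < @cosc R ^+ 2 / 32 by rewrite divr_gt0// exprn_gt0// cosc_gt0.
have c2le : @cosc R ^+ 2 / 32 <= 10.
  have : @cosc R ^+ 2 <= 1 by rewrite expr_le1// ?cosc_le1// ltW// cosc_gt0.
  lra.
split.
- move=> theta t1 t2 t3 t4.
  exists [set tree_freq theta ij | ij in tree_edges], (cosc ^+ 2 / 32), 10.
  split=> //; first exact: countable_tree_freq.
  exact/(rho_fourier_frame hmu4 hmu16)/cos_neq0.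
- move=> theta theta_pi; apply: (rho_not_frame_spectral hmu4 hmu16).
  by case: theta_pi => ->; rewrite ?cosN cos_pihalf.
- exists (cosc ^+ 2 / 32), 10; split=> // theta t1 t2 t3 t4.
  exists [set tree_freq theta ij | ij in tree_edges]; split.
    exact: countable_tree_freq.
  exact/(rho_fourier_frame hmu4 hmu16)/cos_neq0.
Qed.
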